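(* There exist groups that are of type $FP_2(\mathbb{Q})$ and of type $FP_2(\mathbb{Z}/p\mathbb{Z})$ for all primes $p$, but not of type $FP_2(\mathbb{Z})$.
   Context: A group $G$ is of type $FP_n(R)$, for a ring $R$, if there is an exact sequence $P_n\to\dots\to P_1\to P_0\to R\to 0$ of projective $RG$-modules such that each $P_i$ is finitely generated, where $R$ is the trivial $RG$-module. *)

(* Defs.v *)
From HB Require Import structures.
From mathcomp Require Import all_boot all_order all_algebra.
From mathcomp Require Import finmap monalg.

Set Implicit Arguments.
Unset Strict Implicit.
Unset Printing Implicit Defensive.

Import GRing.Theory.

Local Open Scope fset_scope.
Local Open Scope ring_scope.

(* monalg makes {malg R[K]} a ring only when K is a monomType, which excludes *)
(* nontrivial groups (u * v = 1 must force u = v = 1); so only the additive   *)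
(* group {malg R[G]} is reused, and the convolution product is defined anew.  *)
Definition group_ring (R : nzRingType) (G : groupType) : Type := {malg R[G]}.

Section GroupRing.
Context (R : nzRingType) (G : groupType).

HB.instance Definition _ := GRing.Zmodule.copy (group_ring R G) {malg R[G]}.

Implicit Types (a b c : {malg R[G]}) (g h : G).

Definition grmul a b : {malg R[G]} :=
  \sum_(g <- msupp a) \sum_(h <- msupp b) << a@_g * b@_h *g (g * h)%g >>.

Definition grone : {malg R[G]} := << 1 *g 1%g >>.

Lemma grmulw (d1 d2 : {fset G}) a b : msupp a `<=` d1 -> msupp b `<=` d2 ->
  grmul a b = \sum_(g <- d1) \sum_(h <- d2) << a@_g * b@_h *g (g * h)%g >>.
Proof.
move=> le1 le2; rewrite /grmul (big_fset_incl _ le1) /=.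
  apply/eq_bigr=> g _; apply/big_fset_incl => // h _ /mcoeff_outdom ->.
  by rewrite mulr0 monalgU0.
move=> g _ /mcoeff_outdom ag.
by rewrite big1 => // h _; rewrite ag mul0r monalgU0.
Qed.

Lemma grmul0l : left_zero 0 grmul.
Proof. by move=> a; rewrite /grmul msupp0 big_seq_fset0. Qed.

Lemma grmul0r : right_zero 0 grmul.
Proof.
by move=> a; rewrite /grmul msupp0 big1 // => g _; rewrite big_seq_fset0.
Qed.

Lemma grmulDl : left_distributive grmul +%R.
Proof.
move=> a b c; rewrite [grmul a c](grmulw (fsubsetUl _ (msupp b)) (fsubset_refl _)).
rewrite [grmul b c](grmulw (fsubsetUr (msupp a) _) (fsubset_refl _)).
rewrite (grmulw (msuppD_le _ _) (fsubset_refl _)) -big_split /=.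
apply/eq_bigr=> g _; rewrite -big_split /=; apply/eq_bigr=> h _.
by rewrite mcoeffD mulrDl monalgUD.
Qed.

Lemma grmulDr : right_distributive grmul +%R.
Proof.
move=> a b c; rewrite [grmul a b](grmulw (fsubset_refl _) (fsubsetUl _ (msupp c))).
rewrite [grmul a c](grmulw (fsubset_refl _) (fsubsetUr (msupp b) _)).
rewrite (grmulw (fsubset_refl _) (msuppD_le _ _)) -big_split /=.
apply/eq_bigr=> g _; rewrite -big_split /=; apply/eq_bigr=> h _.
by rewrite mcoeffD mulrDr monalgUD.
Qed.

Lemma grmulUU (x y : R) g h :
  grmul << x *g g >> << y *g h >> = << x * y *g (g * h)%g >>.
Proof. by rewrite (grmulw msuppU_le msuppU_le) !big_seq_fset1 !mcoeffUU. Qed.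

Lemma grmul_suml I (r : seq I) (F : I -> {malg R[G]}) b :
  grmul (\sum_(i <- r) F i) b = \sum_(i <- r) grmul (F i) b.
Proof. exact: (big_morph (grmul^~ b) (fun _ _ => grmulDl _ _ _) (grmul0l _)). Qed.

Lemma grmul_sumr I (r : seq I) (F : I -> {malg R[G]}) a :
  grmul a (\sum_(i <- r) F i) = \sum_(i <- r) grmul a (F i).
Proof. exact: (big_morph (grmul a) (fun _ _ => grmulDr _ _ _) (grmul0r _)). Qed.

Lemma grmulA : associative grmul.
Proof.
move=> a b c; rewrite (monalgE a) !grmul_suml; apply/eq_bigr=> g _.
rewrite (monalgE b) !(grmul_suml, grmul_sumr); apply/eq_bigr=> h _.
rewrite (monalgE c) !grmul_sumr; apply/eq_bigr=> k _.
by rewrite !grmulUU mulrA mulgA.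
Qed.

Lemma grmul1l : left_id grone grmul.
Proof.
move=> a; rewrite (monalgE a) grmul_sumr; apply/eq_bigr=> g _.
by rewrite grmulUU mul1r mul1g.
Qed.

Lemma grmul1r : right_id grone grmul.
Proof.
move=> a; rewrite (monalgE a) grmul_suml; apply/eq_bigr=> g _.
by rewrite grmulUU mulr1 mulg1.
Qed.

Lemma grone_neq0 : grone != 0.
Proof. by rewrite monalgU_eq0 oner_eq0. Qed.

HB.instance Definition _ := GRing.Zmodule_isNzRing.Build (group_ring R G)
  grmulA grmul1l grmul1r grmulDl grmulDr grone_neq0.

Definition augmentation (a : group_ring R G) : R := \sum_(g <- msupp a) a@_g.

Lemma augmentationw (d : {fset G}) (a : group_ring R G) :
  msupp a `<=` d -> augmentation a = \sum_(g <- d) a@_g.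
Proof.
by move=> le; apply: big_fset_incl => // g _ /mcoeff_outdom.
Qed.

Lemma augmentation_is_zmod_morphism : zmod_morphism augmentation.
Proof.
move=> a b; rewrite (augmentationw (msuppB_le _ _)).
rewrite (augmentationw (fsubsetUl (msupp a) (msupp b))).
rewrite (augmentationw (fsubsetUr (msupp a) (msupp b))) -sumrB.
by apply/eq_bigr=> g _; rewrite mcoeffB.
Qed.

HB.instance Definition _ := GRing.isZmodMorphism.Build (group_ring R G) R
  augmentation augmentation_is_zmod_morphism.

Lemma augmentationU (x : R) g : augmentation << x *g g >> = x.
Proof. by rewrite (augmentationw msuppU_le) big_seq_fset1 mcoeffUU. Qed.

Lemma augmentation_is_monoid_morphism : monoid_morphism augmentation.
Proof.
split=> [|a b]; first exact: augmentationU.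
rewrite -[a * b]/(grmul a b) raddf_sum mulr_suml.
apply/eq_bigr=> g _; rewrite raddf_sum mulr_sumr.
by apply/eq_bigr=> h _; exact: augmentationU.
Qed.

HB.instance Definition _ := GRing.isMonoidMorphism.Build (group_ring R G) R
  augmentation augmentation_is_monoid_morphism.

End GroupRing.

(* R as a left RG-module on which every element of G acts as the identity. *)
Definition trivial_module (R : nzRingType) (G : groupType) : Type := R.

Section TrivialModule.
Context (R : nzRingType) (G : groupType).

HB.instance Definition _ := GRing.Zmodule.copy (trivial_module R G) R.

Definition trivial_scale (a : group_ring R G) (x : trivial_module R G) :
  trivial_module R G := augmentation a * (x : R).

Lemma trivial_scaleA a b x :
  trivial_scale a (trivial_scale b x) = trivial_scale (a * b) x.
Proof. by rewrite /trivial_scale rmorphM mulrA. Qed.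

Lemma trivial_scale1 : left_id 1 trivial_scale.
Proof. by move=> x; rewrite /trivial_scale rmorph1 mul1r. Qed.

Lemma trivial_scaleDr : right_distributive trivial_scale +%R.
Proof. by move=> a x y; rewrite /trivial_scale mulrDr. Qed.

Lemma trivial_scaleDl x : {morph trivial_scale^~ x : a b / a + b}.
Proof. by move=> a b; rewrite /trivial_scale rmorphD mulrDl. Qed.

HB.instance Definition _ := GRing.Zmodule_isLmodule.Build (group_ring R G)
  (trivial_module R G) trivial_scaleA trivial_scale1 trivial_scaleDr
  trivial_scaleDl.

End TrivialModule.

Definition surjective_map (T U : Type) (f : T -> U) : Prop :=
  forall y, exists x, f x = y.

Definition finitely_generated (A : nzRingType) (M : lmodType A) : Prop :=
  exists (n : nat) (e : 'I_n -> M),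
    forall x, exists c : 'I_n -> A, x = \sum_(i < n) c i *: e i.

Definition projective (A : nzRingType) (P : lmodType A) : Prop :=
  forall (M N : lmodType A) (f : {linear M -> N}) (g : {linear P -> N}),
    surjective_map f -> exists h : {linear P -> M}, forall x, f (h x) = g x.

Definition exact_at (A : nzRingType) (U V W : lmodType A)
    (f : {linear U -> V}) (g : {linear V -> W}) : Prop :=
  forall y, g y = 0 <-> exists x, f x = y.

(* Only P 0, ..., P n and d 0, ..., d n.-1 are constrained: they form the     *)
(* sequence P n -> ... -> P 0 -> R -> 0, and P, d are merely prolonged beyond *)
(* them to have total families; there is no exactness condition at P n.      *)
Definition type_FP (n : nat) (R : nzRingType) (G : groupType) : Prop :=
  exists (P : nat -> lmodType (group_ring R G))
         (d : forall i, {linear P i.+1 -> P i})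
         (eps : {linear P 0 -> trivial_module R G}),
  [/\ forall i, (i <= n)%N -> projective (P i) /\ finitely_generated (P i),
      surjective_map eps,
      (0 < n)%N -> exact_at (d 0) eps
    & forall i, (i.+1 < n)%N -> exact_at (d i.+1) (d i)].

(* Main.v *)
From HB Require Import structures.
From mathcomp Require Import all_boot all_order all_algebra.
From mathcomp Require Import finmap monalg boolp ring.
Require Import Defs.

Set Implicit Arguments.
Unset Strict Implicit.
Unset Printing Implicit Defensive.

Import GRing.Theory.

Local Open Scope fset_scope.
Local Open Scope ring_scope.

(** Consider Abels' group: the upper triangular 4x4 matrices over Z[1/2] with
    diagonal (1, 2^m, 2^n, 1). It is finitely presented and its centre K, the
    top right corner, is isomorphic to Z[1/2]. The group G of the theorem is the
    quotient of Abels' group by its centre.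

    The group G is of type FP_2(R) when its relation module with coefficients
    in R is finitely generated. The relators of Abels' group generate a
    submodule, and the quotient by it is the trivial module obtained from K by
    extending scalars to R. For K = Z[1/2] this is R[1/2]: it is generated by 1
    when 2 is invertible in R, and it vanishes when 2 = 0 in R. These two cases
    cover Q and every Z/p. Over the integers, Z[1/2] is not finitely generated,
    and this obstructs FP_2(Z).

    The negative half, abelsq_not_FP2_int, works with 2-cocycles. If G is of
    type FP_2(Z), then a 2-cocycle with values in a trivial module V is
    cohomologous to one with values in a finitely generated subgroup of V
    (FP2_cocycle). The central extension by Z[1/2] gives a cocycle for which
    phi(g, h) - phi(h, g), over commuting pairs g, h, takes every value in
    Z[1/2]; coboundaries do not change this difference, so Z[1/2] would lie in
    a finitely generated subgroup of itself.

    The positive half avoids free groups. Let M be generated by the Fox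
    derivatives of finitely many relators, let E be the group of pairs (v, g)
    with v a vector modulo M of boundary g - 1, and let t_i be the canonical
    lifts of the generators s_i. The kernel of E -> G is the R-module of
    relations of G not explained by the chosen relators. If E -> G has a section
    sec with sec (g s_i) = sec (g) t_i, then that module vanishes and G is of
    type FP_2(R) (type_FP2_presented).

    So it remains to build such a section from twenty relations in E. Each
    elementary matrix extends to a homomorphism from Z[1/2] to E on which the
    torus acts by a weight. Two weights that form a basis of Z^2 allow the torus
    to spread a single commutation relation to all pairs of parameters
    (weight_bracket). The only opposite pairs of weights are those of the
    entries (12), (24) and (13), (34), whose commutators land in the corner.
    A Hall-Witt computation (comm_shift) shows that these commutators form one
    homomorphism from Z[1/2] to the kernel of E -> G. It kills 1 because of the
    last relation, hence it is trivial, as the kernel either has no 2-torsion or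
    has exponent 2 (corner_trivial). *)

(** * Linear maps out of group rings and out of free modules *)

Section LinearExtension.
Context (R : nzRingType) (G : groupType) (V : zmodType) (F : G -> {additive R -> V}).

Definition linext (a : group_ring R G) : V := \sum_(g <- msupp a) F g a@_g.

Lemma linextw (d : {fset G}) (a : group_ring R G) :
  msupp a `<=` d -> linext a = \sum_(g <- d) F g a@_g.
Proof.
by move=> le; apply: big_fset_incl => // g _ /mcoeff_outdom ->; rewrite raddf0.
Qed.

Lemma linext_is_zmod_morphism : zmod_morphism linext.
Proof.
move=> a b; rewrite (linextw (msuppB_le _ _)).
rewrite (linextw (fsubsetUl (msupp a) (msupp b))).
rewrite (linextw (fsubsetUr (msupp a) (msupp b))) -sumrB.
by apply/eq_bigr=> g _; rewrite mcoeffB raddfB.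
Qed.

HB.instance Definition _ := GRing.isZmodMorphism.Build (group_ring R G) V
  linext linext_is_zmod_morphism.

Lemma linextU (x : R) g : linext << x *g g >> = F g x.
Proof. by rewrite (linextw msuppU_le) big_seq_fset1 mcoeffUU. Qed.

End LinearExtension.

Lemma group_ring_ind (R : nzRingType) (G : groupType) (P : group_ring R G -> Prop) :
    (forall a b, P a -> P b -> P (a + b)) -> (forall x g, P << x *g g >>) ->
  forall a, P a.
Proof.
move=> PD PU a; rewrite (monalgE a); apply: (@big_ind (group_ring R G) P) => //.
by have := PU 0 1%g; rewrite monalgU0.
Qed.

Lemma grmulU (R : nzRingType) (G : groupType) (x y : R) (g h : G) :
  (<< x *g g >> : group_ring R G) * << y *g h >> = << x * y *g (g * h)%g >>.
Proof. exact: grmulUU. Qed.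

Section LinearCombination.
Context (A : nzRingType) (P : lmodType A) (n : nat) (e : 'I_n -> P).

Definition lincomb (v : 'rV[A]_n) : P := \sum_(i < n) v 0 i *: e i.

Lemma lincomb_is_linear : linear lincomb.
Proof.
move=> a u v; rewrite /lincomb scaler_sumr -big_split /=.
by apply: eq_bigr => i _; rewrite !mxE scalerDl scalerA.
Qed.

HB.instance Definition _ := GRing.isLinear.Build A 'rV[A]_n P _ lincomb lincomb_is_linear.

End LinearCombination.

(** The coordinates of a lift of the identity along a free cover. Maps out of P
    can then be prescribed by arbitrary formulas in these coordinates, with no
    target module to be built. *)
Lemma dual_basis (A : nzRingType) (P : lmodType A) :
    projective P -> finitely_generated P ->
  exists (n : nat) (e : 'I_n -> P) (h : {linear P -> 'rV[A]_n}),
    forall x, lincomb e (h x) = x.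
Proof.
move=> projP [n [e eP]]; exists n, e.
have [|h hP] := projP _ _ (lincomb e) idfun; last by exists h.
move=> x; have [c ->] := eP x; exists (\row_i c i).
by apply: eq_bigr => i _; rewrite mxE.
Qed.

(** * Cocycles on groups of type FP_2 over the integers *)

Section Cocycle.
Context (G : groupType) (V : zmodType) (phi : G -> G -> V).
Local Notation A := (group_ring int G).

Definition zext (w : G -> V) : A -> V := linext (fun g => *~%R (w g)).
HB.instance Definition _ w := GRing.Additive.on (zext w).

Lemma zextU w n g : zext w << n *g g >> = w g *~ n.
Proof. exact: linextU. Qed.

Lemma zextE w a : zext w a = \sum_(g <- msupp a) w g *~ a@_g.
Proof. by []. Qed.

(** The biadditive extension of a 2-cochain. On the augmentation ideal it is the
    twisting of the module of the central extension: g sends (k, b) to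
    (k + cup g b, g b). *)
Definition cup (a b : A) : V := zext (fun g => zext (phi g) b) a.

Lemma cupDl a a' b : cup (a + a') b = cup a b + cup a' b.
Proof. exact: raddfD. Qed.

Lemma cupDr a b b' : cup a (b + b') = cup a b + cup a b'.
Proof.
rewrite /cup !zextE -big_split /=; apply: eq_bigr => g _.
by rewrite raddfD mulrzDl.
Qed.

Lemma cupUU n m g h : cup << n *g g >> << m *g h >> = phi g h *~ (n * m).
Proof. by rewrite /cup !zextU mulrC mulrzA. Qed.

Hypothesis phiC : forall g h k,
  phi g h + phi (g * h)%g k = phi g (h * k)%g + phi h k.

(** When augmentation c = 0 this says that the twisted action above is
    associative. *)
Lemma cup_cocycle a b c :
  cup a b *~ augmentation c + cup (a * b) c
  = cup a (b * c) + cup b c *~ augmentation a.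
Proof.
elim/group_ring_ind: a => [a a' IH IH'|x g].
  by rewrite mulrDl !cupDl mulrzDl raddfD /= mulrzDr addrACA IH IH' addrACA.
elim/group_ring_ind: b => [b b' IH IH'|y h].
  by rewrite mulrDl mulrDr !cupDr !cupDl !mulrzDl addrACA IH IH' addrACA.
elim/group_ring_ind: c => [c c' IH IH'|z k].
  by rewrite mulrDr !cupDr raddfD /= mulrzDr !mulrzDl addrACA IH IH' addrACA.
rewrite !grmulU !cupUU !augmentationU -!mulrzA.
rewrite [y * z * x]mulrC [x * (y * z)]mulrA -!mulrzDl.
by rewrite phiC.
Qed.

End Cocycle.

Lemma coboundary_rearrange (V : zmodType) (x a b c ca cb cc : V) :
  x + cb - cc = (c - cc) - (a - ca) - (b - cb) + (a + (b + (x - ca)) - c).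
Proof.
rewrite !opprB !addrA.
by rewrite [RHS](ACl (9*5*2*3*10*7*4*8*6*1*11)%AC) /= !addrK.
Qed.

(** A partial chain map from the resolution to the extension module V + I_G is
    built in degrees 0 and 1. It maps the finitely generated P_2 to V, and v
    lists the images of the generators of P_2. Modulo their span, the chain map
    descends to ker eps, and its values at chosen lifts pi g of g - 1 trivialise
    the cocycle. *)
Lemma FP2_cocycle (G : groupType) (V : zmodType) (phi : G -> G -> V) :
    type_FP 2 int G ->
    (forall g h k, phi g h + phi (g * h)%g k = phi g (h * k)%g + phi h k) ->
  exists (C : G -> V) (m : nat) (v : 'I_m -> V), forall g h,
    exists c : 'I_m -> int,
      phi g h = C (g * h)%g - C g - C h + \sum_(j < m) v j *~ c j.
Proof.
move=> [P [d [eps [projfgP eps_surj ex0 ex1]]]] phiC.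
have [projP0 fgP0] := projfgP 0 isT; have [projP1 fgP1] := projfgP 1 isT.
have [_ [m [e2 e2P]]] := projfgP 2 isT.
have {}ex0 := ex0 isT; have {}ex1 := ex1 0 isT.
have [n0 [e0 [h0 h0K]]] := dual_basis projP0 fgP0.
have [n1 [e1 [h1 h1K]]] := dual_basis projP1 fgP1.
have d01 x : d 0 (d 1 x) = 0 by apply/ex1; exists x.
have epsd x : eps (d 0 x) = 0 by apply/ex0; exists x.
(* th covers the identity of the trivial module in degree 0. *)
pose u0 i : group_ring int G := << (eps (e0 i) : int) *g 1%g >>.
pose th : {linear P 0 -> (group_ring int G)^o} :=
  lincomb (u0 : 'I_n0 -> (group_ring int G)^o) \o h0.
have augth x : augmentation (th x) = eps x.
  rewrite -{2}[x]h0K linear_sum raddf_sum; apply: eq_bigr => i _ /=.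
  by rewrite rmorphM linearZ /= augmentationU.
pose b i : group_ring int G := th (d 0 (e1 i)).
have augb i : augmentation (b i) = 0 by rewrite augth epsd.
(* chi is the V-component of the map P 1 -> V + I_G whose I_G-component is
   th \o d 0; chiZ is its linearity for the twisted action. *)
pose chi x := \sum_(i < n1) cup phi (h1 x 0 i) (b i).
have chiD x y : chi (x + y) = chi x + chi y.
  rewrite /chi -big_split; apply: eq_bigr => i _ /=.
  by rewrite linearD mxE cupDl.
have cup0 a : cup phi a 0 = 0.
  by have := cupDr phi a 0 0; rewrite addr0 -{1}[cup _ _ _]addr0 => /addrI.
have chiZ a x : chi (a *: x) = chi x *~ augmentation a + cup phi a (th (d 0 x)).
  have -> : th (d 0 x) = \sum_(i < n1) h1 x 0 i * b i.
    rewrite -{1}[x]h1K /lincomb !linear_sum; apply: eq_bigr => i _.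
    by rewrite !linearZ.
  rewrite (big_morph (cup phi a) (cupDr phi a) (cup0 a)).
  rewrite mulrz_suml addrC -big_split; apply: eq_bigr => i _ /=.
  have := cup_cocycle phiC a (h1 x 0 i) (b i).
  by rewrite augb mulr0z add0r linearZ mxE.
have [p0 p0P] := eps_surj 1.
pose U g : group_ring int G := << 1 *g g >>.
have /boolp.choice [pi piP] : forall g, exists y, d 0 y = U g *: p0 - p0.
  move=> g; apply/ex0; rewrite linearB linearZ /= p0P.
  by rewrite [X in X - _]/(trivial_scale _ _) /trivial_scale augmentationU mul1r subrr.
pose u : group_ring int G := th p0.
have augu : augmentation u = 1 by rewrite augth.
(* The lift th p0 of 1 is an element u of augmentation 1, not 1 itself; the term
   cup (U g) u corrects for the difference. *)
exists (fun g => chi (pi g) - cup phi (U g) u), m, (fun j => chi (d 1 (e2 j))).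
move=> g h; pose y := pi g + U g *: pi h - pi (g * h)%g.
have chi0 : chi 0 = 0.
  by have := chiD 0 0; rewrite addr0 -{1}[chi 0]addr0 => /addrI.
have chiB x x' : chi (x - x') = chi x - chi x'.
  by apply: (addIr (chi x')); rewrite -chiD !subrK.
have cupB a x x' : cup phi a (x - x') = cup phi a x - cup phi a x'.
  by apply: (addIr (cup phi a x')); rewrite -cupDr !subrK.
(* y measures the failure of pi to be a derivation; it is a cycle. *)
have [x yP] : exists x, d 1 x = y.
  apply/ex1; rewrite /y linearB linearD linearZ /= !piP scalerBr scalerA.
  rewrite /U grmulU mulr1 [_ *: p0 - p0 + _]addrC addrA subrK.
  by rewrite opprB addrA subrK subrr.
have [a aP] := e2P x; exists (fun j => augmentation (a j)).
have chiy : chi y = \sum_(j < m) chi (d 1 (e2 j)) *~ augmentation (a j).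
  rewrite -yP aP linear_sum (big_morph chi chiD chi0); apply: eq_bigr => j _.
  by rewrite linearZ chiZ d01 linear0 cup0 addr0.
have piE : th (d 0 (pi h)) = U h * u - u.
  by rewrite piP linearB; congr (_ - _); exact: linearZ.
have yE : chi y = chi (pi g) + (chi (pi h) + (cup phi (U g) (U h * u) - cup phi (U g) u))
                  - chi (pi (g * h)%g).
  by rewrite /y chiB chiD chiZ piE cupB augmentationU mulr1z.
rewrite -chiy yE.
have := cup_cocycle phiC (U g) (U h) u.
rewrite augu augmentationU !mulr1z grmulU cupUU mulr1 mulr1z -/(U _) => /eqP.
rewrite [_ == _ + _]eq_sym.
rewrite -subr_eq => /eqP <-.
exact: coboundary_rearrange.
Qed.

(** * A criterion for type FP_2 in terms of a derivation modulo relators *)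

Lemma projective_rV (A : nzRingType) n : projective ('rV[A]_n : lmodType A).
Proof.
move=> M N f g fsurj.
have [e eP] : exists e : 'I_n -> M, forall i, f (e i) = g (delta_mx 0 i).
  by have /boolp.choice[e eP] i := fsurj (g (delta_mx 0 i)); exists e.
exists (lincomb e) => v; rewrite {2}[v]row_sum_delta !linear_sum.
by apply: eq_bigr => i _; rewrite !linearZ eP.
Qed.

Lemma finitely_generated_rV (A : nzRingType) n : finitely_generated ('rV[A]_n : lmodType A).
Proof.
exists n, (fun i => delta_mx 0 i) => v; exists (v 0).
exact: row_sum_delta.
Qed.

Section Criterion.
Context (R : nzRingType) (G : groupType) (n : nat) (s : 'I_n -> G).
Local Notation A := (group_ring R G).

Definition grU (x : R) (g : G) : A := << x *g g >>.
(** As a map of row vectors, v |-> v *m boundary sends the i-th basis vector to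
    s_i - 1: it is the start of the resolution given by the generators s. *)
Definition boundary : 'cV[A]_n := \col_i (grU 1 (s i) - 1).

Definition augrow (v : 'rV[A]_1) : trivial_module R G := augmentation (v 0 0).

Lemma augrow_is_linear : linear augrow.
Proof. by move=> a u v; rewrite /augrow !mxE rmorphD rmorphM. Qed.

HB.instance Definition _ := GRing.isLinear.Build A 'rV[A]_1 (trivial_module R G) _
  augrow augrow_is_linear.

Lemma grUM x y g h : grU x g * grU y h = grU (x * y) (g * h)%g.
Proof. exact: grmulU. Qed.

Lemma augrow_boundary (x : 'rV[A]_n) : augrow (x *m boundary) = 0.
Proof.
rewrite /augrow mxE raddf_sum big1 // => i _ /=.
by rewrite rmorphM mxE rmorphB rmorph1 /= augmentationU subrr mulr0.
Qed.

(** The linear extension L of der is a contracting homotopy up to the row span of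
    M: L (a (s_i - 1)) agrees with a e_i modulo M, so that a cycle v is congruent
    to L (v *m boundary) = L 0 = 0, that is, lies in the row span of M. The second
    hypothesis also yields exactness in degree 0. *)
Lemma type_FP2_rows m (M : 'M[A]_(m, n)) (der : G -> 'rV[A]_n) :
    M *m boundary = 0 ->
    (forall h, der h *m boundary = (grU 1 h - 1)%:M) ->
    (forall h i, exists x, x *m M = der (h * s i)%g - der h - grU 1 h *: delta_mx 0 i) ->
  type_FP 2 R G.
Proof.
move=> M0 derE derM.
(* Ranks of the free modules; they are 0 from degree 3 on. *)
pose k i := match i with 0 => 1 | 1 => n | 2 => m | _ => 0 end%N.
pose D i : 'M[A]_(k i.+1, k i) :=
  match i with 0 => boundary | 1 => M | _ => 0 end.
have Fadd g : zmod_morphism (fun x : R => grU x 1%g *: der g).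
  by move=> x y; rewrite -scalerBl; congr (_ *: _); exact: monalgUB.
pose F g : {additive R -> 'rV[A]_n} := HB.pack (fun x : R => grU x 1%g *: der g)
   (GRing.isZmodMorphism.Build _ _ _ (Fadd g)).
pose L : {additive A -> 'rV[A]_n} := linext F.
have LU x h : L (grU x h) = grU x 1%g *: der h by exact: linextU.
have LE a : L a *m boundary = (a - grU (augmentation a) 1%g)%:M.
  elim/group_ring_ind: a => [a b IHa IHb|x h].
    rewrite [L _]raddfD mulmxDl IHa IHb -raddfD; congr (_%:M).
    by rewrite [augmentation (a + b)]raddfD /grU monalgUD opprD addrACA.
  rewrite LU -scalemxAl derE scale_scalar_mx; congr (_%:M).
  by rewrite mulrBr mulr1 grUM mulr1 mul1g augmentationU.
have LM a i : exists x, x *m M = L (a * (grU 1 (s i) - 1)) - a *: delta_mx 0 i.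
  elim/group_ring_ind: a => [a b [x xE] [y yE]|x h].
    exists (x + y); rewrite mulmxDl xE yE mulrDl (raddfD L) scalerDl.
    by rewrite opprD addrACA.
  have [y yE] := derM h i; exists (grU x 1%g *: y); rewrite -scalemxAl yE.
  rewrite mulrBr mulr1 -/(grU x h) grUM mulr1 (raddfB L) !LU.
  by rewrite scalerBr scalerBr scalerA grUM mulr1 mul1g; congr (_ - _ - _).
exists (fun i => 'rV[A]_(k i)), (fun i => mulmxr (D i)), augrow; split.
- by move=> i _; split; [exact: projective_rV | exact: finitely_generated_rV].
- move=> x; exists ((grU x 1%g)%:M); rewrite /= /augrow mxE eqxx.
  exact: augmentationU.
- move=> _ y; split=> [y0|[x <-]] /=; last first.
    exact: augrow_boundary.
  exists (L (y 0 0)); rewrite LE [augmentation _]y0 /grU monalgU0 subr0.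
  by apply/rowP => i; rewrite ord1 mxE eqxx.
- move=> [|//] _ y; split=> [y0|[x <-]] /=.
    have /boolp.choice [x xP] i := LM (y 0 i) i.
    exists (- \sum_i x i); rewrite mulNmx mulmx_suml (eq_bigr _ (fun i _ => xP i)).
    rewrite sumrB -row_sum_delta -raddf_sum /= opprB.
    suff -> : \sum_i y 0 i * (grU 1 (s i) - 1) = 0 by rewrite raddf0 subr0.
    have := congr1 (fun w : 'rV_1 => w 0 0) y0; rewrite !mxE => {2}<-.
    by apply: eq_bigr => i _; rewrite mxE.
  by rewrite -mulmxA M0 mulmx0.
Qed.

End Criterion.

(** * The extension of G in which a finite list of relators holds *)

Section Representatives.
Context (V : zmodType) (S : V -> Prop).

Definition congr_mod (v w : V) : Prop := S (v - w).
Local Notation "v === w" := (congr_mod v w) (at level 70).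

(** A canonical representative of the class of v modulo S, used to realise a
    quotient group as a type of representatives: choose depends only on the
    extension of its predicate. *)
Definition canon (v : V) : V := choose (fun w => `[< v === w >]) v.

Hypotheses (S0 : S 0) (SB : forall v w, S v -> S w -> S (v - w)).

Lemma congr_refl v : v === v. Proof. by rewrite /congr_mod subrr. Qed.

Lemma congr_sym v w : v === w -> w === v.
Proof. by move=> vw; rewrite /congr_mod -opprB -[- _]add0r; exact: SB. Qed.

Lemma congr_trans w v u : v === w -> w === u -> v === u.
Proof.
move=> vw /congr_sym uw; have := SB vw uw; rewrite /congr_mod opprB.
by rewrite addrA addrNK.
Qed.

Lemma congrD v v' w w' : v === v' -> w === w' -> v + w === v' + w'.
Proof.
move=> vv' /congr_sym ww'; have := SB vv' ww'; rewrite /congr_mod.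
by rewrite opprB opprD addrACA.
Qed.

Lemma canonK v : canon v === v.
Proof.
apply/congr_sym/asboolP/(chooseP (P := fun w => `[< v === w >])).
exact/asboolP/congr_refl.
Qed.

Lemma canon_eq v w : v === w -> canon v = canon w.
Proof.
move=> vw; rewrite /canon.
have eqvw : (fun u => `[< v === u >]) =1 (fun u => `[< w === u >]).
  move=> u; apply/asboolP/asboolP; first exact/congr_trans/congr_sym.
  exact: congr_trans.
rewrite (eq_choose eqvw); apply: choose_id; first exact/asboolP/congr_sym.
exact/asboolP/congr_refl.
Qed.

Lemma canon_id v : canon (canon v) = canon v.
Proof. exact/canon_eq/canonK. Qed.

End Representatives.

Definition eval (G : groupType) (n : nat) (s : 'I_n -> G) (w : seq 'I_n) : G :=
  (\prod_(i <- w) s i)%g.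

Section FoxQuotient.
Context (R : nzRingType) (G : groupType) (n : nat) (s : 'I_n -> G).
Context (m : nat) (lhs rhs : 'I_m -> seq 'I_n).
Local Notation A := (group_ring R G).

(** The Fox derivative, restricted to positive words: the unique derivation that
    maps each generator to its basis vector. *)
Fixpoint fox (w : seq 'I_n) : 'rV[A]_n :=
  if w is i :: w' then delta_mx 0 i + grU 1 (s i) *: fox w' else 0.

Lemma fox_boundary w : fox w *m boundary R s = (grU 1 (eval s w) - 1)%:M.
Proof.
elim: w => [|i w IH].
  by rewrite mul0mx /eval big_nil subrr raddf0.
rewrite /= mulmxDl -scalemxAl IH scale_scalar_mx -rowE mulrBr mulr1 grUM mulr1.
rewrite /eval big_cons.
have -> : row i (boundary R s) = (grU 1 (s i) - 1)%:M.
  by apply/rowP => j; rewrite ord1 !mxE eqxx.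
by rewrite -raddfD /= addrC addrA subrK.
Qed.

Definition relators : 'M[A]_(m, n) := \matrix_j (fox (lhs j) - fox (rhs j)).

Definition relmod (v : 'rV[A]_n) : Prop := exists x, x *m relators = v.

Lemma relmod0 : relmod 0. Proof. by exists 0; rewrite mul0mx. Qed.

Lemma relmodB v w : relmod v -> relmod w -> relmod (v - w).
Proof. by move=> [x <-] [y <-]; exists (x - y); rewrite mulmxBl. Qed.

Lemma relmodZ a v : relmod v -> relmod (a *: v).
Proof. by move=> [x <-]; exists (a *: x); rewrite -scalemxAl. Qed.

Hypothesis rels : forall j, eval s (lhs j) = eval s (rhs j).

Lemma relators_boundary : relators *m boundary R s = 0.
Proof.
apply/row_matrixP => j; rewrite row_mul rowK mulmxBl !fox_boundary rels subrr.
by rewrite row0.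
Qed.

Lemma relmod_boundary v : relmod v -> v *m boundary R s = 0.
Proof. by move=> [x <-]; rewrite -mulmxA relators_boundary mulmx0. Qed.

(** The pairs (v, g) with v *m boundary = g - 1, v taken modulo relmod, form a group
    under (v, g) (w, h) = (v + g w, g h), an extension of G by the module of
    cycles modulo relators. *)
Definition foxext_pred (x : 'rV[A]_n * G) : bool :=
  (x.1 *m boundary R s == (grU 1 x.2 - 1)%:M) && (canon relmod x.1 == x.1).

Definition foxext : Type := {x : 'rV[A]_n * G | foxext_pred x}.
HB.instance Definition _ := Choice.on foxext.

Local Notation "v === w" := (congr_mod relmod v w) (at level 70).

Lemma canon_boundary v : canon relmod v *m boundary R s = v *m boundary R s.
Proof.
apply/eqP; rewrite -subr_eq0 -mulmxBl; apply/eqP/relmod_boundary.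
exact: (canonK relmod0 (@relmodB)).
Qed.

Lemma foxext_subproof v g : v *m boundary R s = (grU 1 g - 1)%:M ->
  foxext_pred (canon relmod v, g).
Proof.
move=> vg; rewrite /foxext_pred /= canon_boundary vg eqxx /=.
by apply/eqP/(canon_id relmod0 (@relmodB)).
Qed.

Definition foxext_mk v g (vg : v *m boundary R s = (grU 1 g - 1)%:M) : foxext :=
  exist foxext_pred _ (foxext_subproof vg).

Definition foxext_vec (x : foxext) : 'rV[A]_n := (val x).1.
Definition foxext_pr (x : foxext) : G := (val x).2.

Lemma foxext_vecE x : foxext_vec x *m boundary R s = (grU 1 (foxext_pr x) - 1)%:M.
Proof. by case/andP: (valP x) => /eqP. Qed.

Lemma foxext_eq x y : foxext_pr x = foxext_pr y -> foxext_vec x === foxext_vec y -> x = y.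
Proof.
move=> eqpr /(canon_eq relmod0 (@relmodB)) eqv; apply: val_inj; move: eqpr eqv.
case/andP: (valP x) => _ /eqP; case/andP: (valP y) => _ /eqP.
rewrite /foxext_pr /foxext_vec => -> -> .
by case: (val x) (val y) => [v g] [w h] /= -> ->.
Qed.

Lemma foxext_mk_vec v g (vg : v *m boundary R s = (grU 1 g - 1)%:M) : 
  foxext_vec (foxext_mk vg) === v.
Proof. exact: (canonK relmod0 (@relmodB)). Qed.

Lemma foxext_mul_subproof x y :
  (foxext_vec x + grU 1 (foxext_pr x) *: foxext_vec y) *m boundary R s
    = (grU 1 (foxext_pr x * foxext_pr y)%g - 1)%:M.
Proof.
rewrite mulmxDl -scalemxAl !foxext_vecE scale_scalar_mx -raddfD /=.
by rewrite mulrBr mulr1 grUM mulr1 addrC addrA subrK.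
Qed.

Lemma foxext_one_subproof : (0 : 'rV[A]_n) *m boundary R s = (grU 1 1%g - 1)%:M.
Proof. by rewrite mul0mx subrr raddf0. Qed.

Lemma foxext_inv_subproof x :
  (- (grU 1 (foxext_pr x)^-1%g *: foxext_vec x)) *m boundary R s
    = (grU 1 (foxext_pr x)^-1%g - 1)%:M.
Proof.
rewrite mulNmx -scalemxAl foxext_vecE scale_scalar_mx -raddfN /=.
by rewrite mulrBr mulr1 grUM mulr1 mulVg opprB.
Qed.

Definition foxext_mul x y := foxext_mk (foxext_mul_subproof x y).
Definition foxext_one := foxext_mk foxext_one_subproof.
Definition foxext_inv x := foxext_mk (foxext_inv_subproof x).

Lemma congr_scale a v w : v === w -> a *: v === a *: w.
Proof. by rewrite /congr_mod -scalerBr; exact: relmodZ. Qed.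

Let congrT v w u : w === v -> v === u -> w === u.
Proof. exact: (congr_trans relmod0 (@relmodB)). Qed.
Let congrS v w : v === w -> w === v.
Proof. exact: (congr_sym relmod0 (@relmodB)). Qed.
Let congrR v : v === v. Proof. exact: (congr_refl relmod0). Qed.
Let congrA v v' w w' : v === v' -> w === w' -> v + w === v' + w'.
Proof. exact: (congrD relmod0 (@relmodB)). Qed.

Lemma foxext_mul_vec x y :
  foxext_vec (foxext_mul x y) === foxext_vec x + grU 1 (foxext_pr x) *: foxext_vec y.
Proof. exact: foxext_mk_vec. Qed.

Lemma foxext_mulA : associative foxext_mul.
Proof.
move=> x y z; apply: foxext_eq; first exact: mulgA.
apply: congrT (foxext_mul_vec _ _) _.
apply: congrT (congrA (congrR _) (congr_scale _ (foxext_mul_vec _ _))) _.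
apply/congrS/(congrT (foxext_mul_vec _ _)).
apply: congrT (congrA (foxext_mul_vec _ _) (congrR _)) _.
by rewrite scalerDr scalerA grUM mulr1 addrA; exact: congrR.
Qed.

Lemma foxext_mul1g : left_id foxext_one foxext_mul.
Proof.
move=> x; apply: foxext_eq; first exact: mul1g.
apply: congrT (foxext_mul_vec _ _) _.
apply: congrT (congrA (foxext_mk_vec _) (congrR _)) _.
by rewrite add0r scale1r; exact: congrR.
Qed.

Lemma foxext_mulg1 : right_id foxext_one foxext_mul.
Proof.
move=> x; apply: foxext_eq; first exact: mulg1.
apply: congrT (foxext_mul_vec _ _) _.
apply: congrT (congrA (congrR _) (congr_scale _ (foxext_mk_vec _))) _.
by rewrite scaler0 addr0; exact: congrR.
Qed.

Lemma foxext_mulVg : left_inverse foxext_one foxext_inv foxext_mul.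
Proof.
move=> x; apply: foxext_eq; first exact: mulVg.
apply: congrT (foxext_mul_vec _ _) _.
apply: congrT (congrA (foxext_mk_vec _) (congrR _)) _.
by rewrite addNr; apply/congrS/foxext_mk_vec.
Qed.

Lemma foxext_mulgV : right_inverse foxext_one foxext_inv foxext_mul.
Proof.
move=> x; apply: foxext_eq; first exact: mulgV.
apply: congrT (foxext_mul_vec _ _) _.
apply: congrT (congrA (congrR _) (congr_scale _ (foxext_mk_vec _))) _.
rewrite scalerN scalerA grUM mulr1 mulgV scale1r subrr.
exact/congrS/foxext_mk_vec.
Qed.

HB.instance Definition _ := isGroup.Build foxext
  foxext_mulA foxext_mul1g foxext_mulg1 foxext_mulVg foxext_mulgV.

Definition foxext_group : groupType := foxext.

Lemma foxext_prM x y : foxext_pr (x * y)%g = (foxext_pr x * foxext_pr y)%g.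
Proof. by []. Qed.

Lemma foxext_gen_subproof i :
  (delta_mx 0 i : 'rV[A]_n) *m boundary R s = (grU 1 (s i) - 1)%:M.
Proof. by rewrite -rowE; apply/rowP => j; rewrite ord1 !mxE eqxx. Qed.

Definition foxext_gen i : foxext := foxext_mk (foxext_gen_subproof i).

Lemma foxext_eval w :
  foxext_pr (eval foxext_gen w) = eval s w /\ foxext_vec (eval foxext_gen w) === fox w.
Proof.
elim: w => [|i w [IHp IHv]]; rewrite /eval ?big_nil ?big_cons.
  by split=> //; exact: foxext_mk_vec.
split; first by rewrite foxext_prM IHp.
apply: congrT (foxext_mul_vec _ _) _.
exact: congrA (foxext_mk_vec _) (congr_scale _ IHv).
Qed.

(** The vector of a word in the lifted generators is its Fox derivative, and the
    difference of the derivatives of the two sides of a relation is a generator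
    of relmod. *)
Lemma foxext_rels j : eval foxext_gen (lhs j) = eval foxext_gen (rhs j).
Proof.
have [prl vl] := foxext_eval (lhs j); have [prr vr] := foxext_eval (rhs j).
apply: foxext_eq; first by rewrite prl prr rels.
apply: congrT vl (congrT _ (congrS vr)).
by exists (delta_mx 0 j); rewrite -rowE rowK.
Qed.

Lemma foxext_ker_mul x y : foxext_pr x = 1%g ->
  foxext_vec (x * y)%g === foxext_vec x + foxext_vec y.
Proof. by move=> x1; have := foxext_mul_vec x y; rewrite x1 scale1r. Qed.

Lemma foxext_ker_eq1 x : foxext_pr x = 1%g -> relmod (foxext_vec x) -> x = 1%g.
Proof.
move=> x1 xS; apply: foxext_eq => //; apply: congrT (congrS (foxext_mk_vec _)).
by rewrite /congr_mod subr0.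
Qed.

Lemma foxext_ker_sqr x : foxext_pr x = 1%g ->
  foxext_vec (x * x)%g === grU 2%:R 1%g *: foxext_vec x.
Proof.
move=> x1; have -> : grU 2%:R 1%g = 1 + 1 :> A by exact: monalgUD.
by rewrite scalerDl scale1r; exact: foxext_ker_mul.
Qed.

Lemma foxext_ker_exponent x :
  2%:R = 0 :> R -> foxext_pr x = 1%g -> (x * x)%g = 1%g.
Proof.
move=> R2 x1; apply: foxext_ker_eq1; first by rewrite foxext_prM x1 mulg1.
have := foxext_ker_sqr x1; rewrite R2 /grU monalgU0 scale0r.
by rewrite /congr_mod subr0.
Qed.

Lemma foxext_ker_torsionfree x (h : R) :
  h * 2%:R = 1 :> R -> foxext_pr x = 1%g -> (x * x)%g = 1%g -> x = 1%g.
Proof.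
move=> h2 x1 xx; apply: foxext_ker_eq1 => //.
have := foxext_ker_sqr x1; rewrite xx => /congrS /congrT /(_ (foxext_mk_vec _)).
move=> /(congr_scale (grU h 1%g)); rewrite scalerA grUM h2 mulg1 scale1r scaler0.
by rewrite /congr_mod subr0.
Qed.

(** The vector part of a section compatible with right multiplication by the
    generators is a derivation modulo relators. *)
Lemma type_FP2_of_section (sec : G -> foxext) :
    (forall g, foxext_pr (sec g) = g) ->
    (forall g i, sec (g * s i)%g = (sec g * foxext_gen i)%g) ->
  type_FP 2 R G.
Proof.
move=> secK secM; apply: (type_FP2_rows (der := fun g => foxext_vec (sec g)) relators_boundary).
  by move=> h; rewrite foxext_vecE secK.
move=> h i; rewrite secM; have := foxext_mul_vec (sec h) (foxext_gen i).
move=> /congrT /(_ (congrA (congrR _) (congr_scale _ (foxext_mk_vec _)))).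
by rewrite secK /congr_mod opprD addrA.
Qed.

End FoxQuotient.

(** The extension E is the one above; all that has to be remembered of the
    R-module structure of its kernel is how it reacts to squaring. *)
Theorem type_FP2_presented (R : nzRingType) (G : groupType) (n : nat) (s : 'I_n -> G)
    (m : nat) (lhs rhs : 'I_m -> seq 'I_n) :
    (exists h : R, h * 2%:R = 1) \/ 2%:R = 0 :> R ->
    (forall j, eval s (lhs j) = eval s (rhs j)) ->
    (forall (E : groupType) (pr : E -> G) (t : 'I_n -> E),
       {morph pr : x y / (x * y)%g} -> (forall i, pr (t i) = s i) ->
       (forall j, eval t (lhs j) = eval t (rhs j)) ->
       (forall x, pr x = 1%g -> (x * x)%g = 1%g -> x = 1%g)
         \/ (forall x, pr x = 1%g -> (x * x)%g = 1%g) ->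
     exists sec : G -> E, (forall g, pr (sec g) = g)
       /\ (forall g i, sec (g * s i)%g = (sec g * t i)%g)) ->
  type_FP 2 R G.
Proof.
move=> R2 rels /(_ (foxext_group R rels) (@foxext_pr _ _ _ _ _ _ _) (foxext_gen R rels)) [].
- exact: foxext_prM.
- by [].
- exact: foxext_rels.
- case: R2 => [[h h2]|R2]; [left|right] => x.
    exact: foxext_ker_torsionfree h2.
  exact: foxext_ker_exponent.
by move=> sec [secK secM]; exact: (type_FP2_of_section secK secM).
Qed.

(** * The ring of dyadic rationals and its homomorphisms to groups *)

Definition dyadic : {pred rat} :=
  fun r => `[< exists (m : int) (k : nat), r = m%:~R / 2%:R ^+ k >].

Lemma dyadicP r : reflect (exists (m : int) (k : nat), r = m%:~R / 2%:R ^+ k) (r \in dyadic).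
Proof. exact: asboolP. Qed.

Lemma dyadic_subring_closed : subring_closed dyadic.
Proof.
have n2 k : 2%:R ^+ k != 0 :> rat by rewrite expf_neq0.
split=> [|x y|x y].
- by apply/dyadicP; exists 1, 0; rewrite divr1.
- move=> /dyadicP[m [k ->]] /dyadicP[n [l ->]]; apply/dyadicP.
  exists (m * 2 ^+ l - n * 2 ^+ k), (k + l)%N.
  rewrite rmorphB !rmorphM !rmorphXn /= exprD.
  by field; rewrite !n2.
- move=> /dyadicP[m [k ->]] /dyadicP[n [l ->]]; apply/dyadicP.
  exists (m * n), (k + l)%N.
  by rewrite rmorphM /= exprD; field; rewrite !n2.
Qed.

HB.instance Definition _ := GRing.isSubringClosed.Build rat dyadic dyadic_subring_closed.

Definition dy : Type := {r : rat | r \in dyadic}.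
HB.instance Definition _ := SubChoice.on dy.
HB.instance Definition _ := [SubChoice_isSubComNzRing of dy by <:].

Lemma pw_subproof (i : int) : (2%:R ^ i : rat) \in dyadic.
Proof.
apply/dyadicP; case: i => n.
  by exists (2 ^+ n), 0%N; rewrite divr1 rmorphXn.
by exists 1, n.+1; rewrite mul1r NegzE -exprnN.
Qed.

(** The power 2^i, for positive and negative i. *)
Definition pw (i : int) : dy := exist (fun r => r \in dyadic) _ (pw_subproof i).

Lemma pwD i j : pw (i + j) = pw i * pw j.
Proof. by apply: val_inj; rewrite rmorphM /= expfzDr. Qed.

Lemma pw0 : pw 0 = 1.
Proof. by apply: val_inj; rewrite rmorph1. Qed.

Lemma pw_half i : pw i = pw (i - 1) + pw (i - 1).
Proof.
have -> : pw i = pw (i - 1) * 2%:R.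
  have -> : 2%:R = pw 1 by exact: val_inj.
  by rewrite -pwD subrK.
by rewrite mulr2n mulrDr mulr1.
Qed.

Lemma pwNK i : pw (- i) * pw i = 1.
Proof. by rewrite -pwD addNr pw0. Qed.

Lemma dy_repr (r : dy) : exists (m : int) (k : nat), r = m%:~R * pw (- k%:Z).
Proof.
have /dyadicP [m [k rE]] := valP r; exists m, k.
by apply: val_inj; rewrite rmorphM rmorph_int /= -exprnN.
Qed.

Lemma dy_ind (P : dy -> Prop) :
    (forall i, P (pw i)) -> (forall r s, P r -> P s -> P (r + s)) ->
    (forall r, P r -> P (- r)) ->
  forall r, P r.
Proof.
move=> Ppw PD PN r; have [m [k ->]] := dy_repr r.
have P0 : P 0 by rewrite -(subrr (pw 0)); apply: PD; [|apply: PN].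
have Pn n : P (n%:R * pw (- k%:Z)).
  elim: n => [|n IH]; first by rewrite mul0r.
  by rewrite -addn1 natrD mulrDl mul1r; apply: PD.
by case: m => n; rewrite ?NegzE ?mulrNz ?mulNr; [|apply: PN]; exact: Pn.
Qed.

Section IntegerPowers.
Context (E : groupType).
Implicit Types (x y g : E) (m n : int).
Local Open Scope group_scope.

Definition zpow x m : E := match m with Posz n => x ^+ n | Negz n => x ^- n.+1 end.

Lemma zpowB x (a b : nat) : zpow x (a%:Z - b%:Z)%R = x ^+ a / x ^+ b.
Proof.
have [ba|/ltnW ab] := leqP b a.
  by rewrite subzn //= expgnFr.
rewrite -opprB subzn //; case e : (b - a)%N => [|k].
  have -> : a = b by apply/eqP; rewrite eqn_leq ab -subn_eq0 e.
  by rewrite /= divgg.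
by rewrite -NegzE /= -e expgnFr // invgF.
Qed.

Lemma int_natB m : exists a b : nat, m = (a%:Z - b%:Z)%R.
Proof.
case: m => n; [exists n, 0%N; exact/esym/subr0|exists 0%N, n.+1].
by rewrite NegzE sub0r.
Qed.

Lemma zpowD x m n : zpow x (m + n)%R = zpow x m * zpow x n.
Proof.
have [a [b ->]] := int_natB m; have [c [d ->]] := int_natB n.
have -> : (a%:Z - b%:Z + (c%:Z - d%:Z) = (a + c)%N%:Z - (b + d)%N%:Z)%R.
  by rewrite !PoszD opprD addrACA.
rewrite !zpowB !expgnDr invgM -!mulgA; congr (_ * _).
have cxx k l : commute (x ^+ k) (x ^+ l) by exact/commuteX2.
rewrite mulgA; apply/commute_sym/commute_sym/commuteV/commute_sym.
by apply: commuteM => //; exact: commuteV.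
Qed.

Lemma zpowXg x m : zpow (x ^+ 2) m = zpow x (m * 2)%R.
Proof.
rewrite mulr2n mulrDr mulr1 zpowD; case: m => n /=; first by rewrite expgnAC.
by rewrite expgnAC expg2 invgM.
Qed.

Lemma conj_zpow x m g : (zpow x m) ^ g = zpow (x ^ g) m.
Proof. by case: m => n /=; rewrite ?conjVg conjXg. Qed.

End IntegerPowers.

Definition dy_hom (E : groupType) (X : dy -> E) : Prop :=
  {morph X : r s / r + s >-> (r * s)%g}.

Section DyadicHoms.
Context (E : groupType).
Implicit Types (x g h : E) (X Y : dy -> E).

Lemma dy_hom0 X : dy_hom X -> X 0 = 1%g.
Proof. by move=> XD; apply: (@mulgI _ (X 0)); rewrite -XD addr0 mulg1. Qed.

Lemma dy_homN X r : dy_hom X -> X (- r) = ((X r)^-1)%g.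
Proof. by move=> XD; apply: (@mulgI _ (X r)); rewrite -XD subrr dy_hom0 ?mulgV. Qed.

Lemma dy_hom_eq X Y : dy_hom X -> dy_hom Y -> (forall i, X (pw i) = Y (pw i)) -> X =1 Y.
Proof.
move=> XD YD XY; elim/dy_ind => // [r s Xr Xs|r Xr]; first by rewrite XD YD Xr Xs.
by rewrite !dy_homN ?Xr.
Qed.

Lemma dy_hom_conj X g : dy_hom X -> dy_hom (fun r => (X r ^ g)%g).
Proof. by move=> XD r s; rewrite XD conjMg. Qed.

Lemma dy_hom_scale X c : dy_hom X -> dy_hom (fun r => X (c * r)).
Proof. by move=> XD r s; rewrite mulrDr XD. Qed.

(** In the group generated by x and g the relation g x g^-1 = x^2 gives x a
    square root g^-1 x g, a fourth root, and so on: the value at m / 2^k is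
    g^-k x^m g^k. *)
Lemma dy_hom_extend x g : (x ^ g^-1 = x ^+ 2)%g ->
  exists X, [/\ dy_hom X, X 1 = x & forall r, (X r ^ g^-1)%g = X (pw 1 * r)].
Proof.
move=> xg; pose par m k := (zpow x m ^ (g ^+ k))%g.
have par2 m k : par (m * 2) k.+1 = par m k.
  by rewrite /par -zpowXg -xg -conj_zpow expgS conjgM conjgKV.
have par_shift m k l : par (m * 2 ^+ l) (l + k)%N = par m k.
  by elim: l => [|l IH]; rewrite ?mulr1 // exprSr mulrA par2.
have par_uniq m k n l : m%:~R * pw (- k%:Z) = n%:~R * pw (- l%:Z) -> par m k = par n l.
  move=> e; rewrite -(par_shift m k l) -(par_shift n l k) addnC; congr (par _ _).
  apply: (@intr_inj rat); rewrite !rmorphM !rmorphXn /=.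
  move/(congr1 val): e; rewrite !rmorphM !rmorph_int /= -!exprnN.
  move=> /(congr1 (fun r => r * 2%:R ^+ k * 2%:R ^+ l)).
  have n2 i : 2%:R ^+ i != 0 :> rat by rewrite expf_neq0.
  by rewrite divfK // mulrAC divfK.
have /boolp.choice [X XE] : forall r, exists y, forall m k,
    r = m%:~R * pw (- k%:Z) -> y = par m k.
  move=> r; have [m [k rE]] := dy_repr r; exists (par m k) => n l rE'.
  by apply: par_uniq; rewrite -rE.
exists X; split.
- move=> r s; have [m [k rE]] := dy_repr r; have [n [l sE]] := dy_repr s.
  rewrite (XE _ _ _ rE) (XE _ _ _ sE).
  have pwX i : (2 ^+ i)%:~R = pw i%:Z by apply: val_inj; rewrite rmorph_int rmorphXn.
  rewrite (XE _ (m * 2 ^+ l + n * 2 ^+ k) (k + l)%N).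
    rewrite -(par_shift m k l) -(par_shift n l k) [(l + k)%N]addnC.
    by rewrite /par zpowD conjMg.
  rewrite rE sE PoszD opprD pwD rmorphD !rmorphM /= !pwX.
  rewrite mulrDl mulrACA [pw l%:Z * _]mulrC pwNK mulr1; congr (_ + _).
  by rewrite [pw (- k%:Z) * _]mulrC mulrACA [pw k%:Z * _]mulrC pwNK mulr1.
- by rewrite (XE _ 1 0%N) ?oppr0 ?pw0 ?mulr1 // /par conjg1.
- move=> r; have [m [k rE]] := dy_repr r; rewrite (XE _ _ _ rE).
  rewrite (XE _ (m * 2) k); last first.
    by rewrite rE rmorphM /= mulrA [pw 1 * _]mulrC; congr (_ * _ * _); apply: val_inj.
  rewrite /par -zpowXg -xg -conj_zpow -!conjgM; congr (_ ^ _)%g.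
  have cg : commute (g ^+ k)%g g by exact/commute_sym/commuteX.
  exact: commuteV cg.
Qed.

End DyadicHoms.

Section TorusWeights.
Context (E : groupType) (t s : E).
Implicit Types (X Y W : dy -> E) (i j a b : int).

(** The pair (al, be) is the weight of the root subgroup X under the torus
    generated by t and s. *)
Definition weight_hom (al be : int) X : Prop :=
  [/\ dy_hom X, forall r, (X r ^ t^-1)%g = X (pw al * r)
    & forall r, (X r ^ s^-1)%g = X (pw be * r)].

Definition torus a b : E := (zpow t a * zpow s b)%g.

Lemma conj_zpowV X g al a r : (forall r, (X r ^ g^-1)%g = X (pw al * r)) ->
  (X r ^ (zpow g a)^-1)%g = X (pw (al * a) * r).
Proof.
move=> Xg.
have Xn n q : (X q ^ (g ^+ n)^-1)%g = X (pw (al * n%:Z) * q).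
  elim: n q => [|n IH] q; first by rewrite mulr0 pw0 mul1r invg1 conjg1.
  by rewrite expgS invgM conjgM IH Xg mulrA -pwD -addn1 PoszD mulrDr mulr1 addrC.
case: a => n /=; first exact: Xn.
have e : (X r = X (pw (al * Negz n) * r)%R ^ g ^- n.+1)%g.
  by rewrite Xn mulrA -pwD NegzE mulrN subrr pw0 mul1r.
by rewrite invgK {1}e conjgKV.
Qed.

Lemma weight_torus al be X a b r : weight_hom al be X ->
  (X r ^ (torus a b)^-1)%g = X (pw (al * a + be * b) * r).
Proof.
move=> [_ Xt Xs]; rewrite /torus invgM conjgM (conj_zpowV _ _ Xs) (conj_zpowV _ _ Xt).
by rewrite mulrA -pwD.
Qed.

Lemma weight_torusE al be X a b r : weight_hom al be X ->
  (torus a b * X r = X (pw (al * a + be * b) * r)%R * torus a b)%g.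
Proof.
move=> fX; rewrite -(weight_torus a b r fX); move: (torus a b) => g.
by rewrite conjgE invgK !mulgA mulgVK.
Qed.

(** Conjugation by t^a s^b moves the parameters (1, 1) to (2^i, 2^j), where (i, j)
    is the image of (a, b) under the matrix of the two weights. This matrix has
    determinant 1 or -1, so every pair of powers of 2 is reached. *)
Lemma weight_spread al be al' be' al'' be'' X Y W :
    weight_hom al be X -> weight_hom al' be' Y -> weight_hom al'' be'' W ->
    al'' = al + al' -> be'' = be + be' ->
    (al * be' - be * al') ^+ 2 = 1 ->
    (X 1%R * Y 1%R = W 1%R * (Y 1%R * X 1%R))%g ->
  forall i j, (X (pw i) * Y (pw j) = W (pw (i + j)%R) * (Y (pw j) * X (pw i)))%g.
Proof.
move=> fX fY fW al''E be''E det1 XY i j.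
pose D := al * be' - be * al'.
(* Cramer's rule; D is its own inverse. *)
pose a := D * (be' * i - be * j); pose b := D * (al * j - al' * i).
have iE : al * a + be * b = i by rewrite -[i]mul1r -det1 /a /b /D; ring.
have jE : al' * a + be' * b = j by rewrite -[j]mul1r -det1 /a /b /D; ring.
have ijE : al'' * a + be'' * b = i + j by rewrite al''E be''E -iE -jE; ring.
have := congr1 (fun g => (g ^ (torus a b)^-1)%g) XY; rewrite /= !conjMg.
rewrite (weight_torus _ _ _ fX) (weight_torus _ _ _ fY) (weight_torus _ _ _ fW).
by rewrite !mulr1 iE jE ijE.
Qed.

(** Powers of 2 generate Z[1/2], and when W commutes with X and Y both sides are
    homomorphic in each parameter. *)
Lemma weight_bracket al be al' be' al'' be'' X Y W :
    weight_hom al be X -> weight_hom al' be' Y -> weight_hom al'' be'' W ->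
    al'' = al + al' -> be'' = be + be' ->
    (al * be' - be * al') ^+ 2 = 1 ->
    (forall r u, commute (W r) (X u)) -> (forall r u, commute (W r) (Y u)) ->
    (X 1%R * Y 1%R = W 1%R * (Y 1%R * X 1%R))%g ->
  forall r u, (X r * Y u = W (r * u)%R * (Y u * X r))%g.
Proof.
move=> fX fY fW al''E be''E det1 WX WY XY.
have spread := weight_spread fX fY fW al''E be''E det1 XY.
have [XD _ _] := fX; have [YD _ _] := fY; have [WD _ _] := fW.
have WXhom c : dy_hom (fun r => (W (- (r * c))%R * X r)%g).
  move=> r r'; rewrite mulrDl opprD WD XD -!mulgA; congr (_ * _)%g.
  by rewrite !mulgA WX.
have WYhom c : dy_hom (fun u => (W (c * u)%R * Y u)%g).
  move=> u u'; rewrite mulrDr WD YD -!mulgA; congr (_ * _)%g.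
  by rewrite !mulgA WY.
have half j r : (X r * Y (pw j) = W (r * pw j)%R * (Y (pw j) * X r))%g.
  have e : (X r ^ (Y (pw j))^-1 = W (- (r * pw j))%R * X r)%g.
    apply: (dy_hom_eq (dy_hom_conj _ XD) (WXhom _)) r => i.
    have YX : (Y (pw j) * X (pw i) = (W (pw (i + j)%R))^-1 * (X (pw i) * Y (pw j)))%g.
      by rewrite spread mulKg.
    by rewrite conjgE invgK mulgA YX dy_homN // pwD -!mulgA mulgV mulg1.
  have -> : (Y (pw j) * X r = X r ^ (Y (pw j))^-1 * Y (pw j))%g.
    by rewrite conjgE invgK !mulgA mulgVK.
  by rewrite e -mulgA dy_homN // mulVKg.
move=> r u; have e : (Y u ^ (X r)^-1 = W (r * u)%R * Y u)%g.
  apply: (dy_hom_eq (dy_hom_conj _ YD) (WYhom _)) u => j.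
  by rewrite conjgE invgK mulgA half -!mulgA mulgV mulg1.
by rewrite mulgA -e conjgE invgK !mulgA mulgVK.
Qed.

Lemma weight_commute al be al' be' X Y :
    weight_hom al be X -> weight_hom al' be' Y ->
    (al * be' - be * al') ^+ 2 = 1 -> commute (X 1) (Y 1) ->
  forall r u, commute (X r) (Y u).
Proof.
move=> fX fY det1 XY.
have f1 : weight_hom (al + al') (be + be') (fun=> 1%g).
  by split=> r // => [?||]; rewrite ?mul1g ?conj1g.
have XY' : (X 1%R * Y 1%R = 1 * (Y 1%R * X 1%R))%g by rewrite mul1g.
have c1 (Z : dy -> E) (r u : dy) : commute 1%g (Z u) by exact/commute_sym/commute1.
move=> r u; have := weight_bracket fX fY f1 erefl erefl det1 (c1 X) (c1 Y) XY' r u.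
by rewrite mul1g.
Qed.

End TorusWeights.

Section WeightsDetermineHoms.
Context (E : groupType) (t s : E).
Implicit Types (X Y W : dy -> E).

(** Both sides are equivariant under g, which moves 1 to all powers of 2. *)
Lemma dy_hom_act X g u c : dy_hom X -> (forall r, (X r ^ g^-1)%g = X (pw 1 * r)) ->
    commute u g -> (X 1%R ^ u^-1)%g = X (pw c) ->
  forall r, (X r ^ u^-1)%g = X (pw c * r).
Proof.
move=> XD Xg ug X1.
have XE i : X (pw i) = (X 1%R ^ (zpow g i)^-1)%g by rewrite (conj_zpowV _ _ Xg) mul1r mulr1.
apply: dy_hom_eq; [exact: dy_hom_conj|exact: dy_hom_scale|move=> i].
have uz : commute u (zpow g i).
  by case: i => n /=; [exact: commuteX | exact/commuteV/commuteX].
rewrite XE -conjgM -invgM uz invgM conjgM X1 (conj_zpowV _ _ Xg).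
by rewrite mul1r mulrC.
Qed.

Lemma dy_hom_actV X g a : (forall r, (X r ^ g^-1)%g = X (pw a * r)) ->
  forall r, (X r ^ (g^-1)^-1)%g = X (pw (- a) * r).
Proof. by move=> Xg r; have := conj_zpowV (- 1) r Xg; rewrite mulrN1. Qed.

Lemma weight_unique al be X Y a b : weight_hom t s al be X -> weight_hom t s al be Y ->
  al * a + be * b = 1 -> X 1 = Y 1 -> X =1 Y.
Proof.
move=> fX fY ab XY; have [XD _ _] := fX; have [YD _ _] := fY.
apply: dy_hom_eq => // i.
have iE : al * (a * i) + be * (b * i) = i by rewrite !mulrA -mulrDl ab mul1r.
have := weight_torus (a * i) (b * i) 1 fX; have := weight_torus (a * i) (b * i) 1 fY.
by rewrite iE !mulr1 XY => -> ->.
Qed.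

End WeightsDetermineHoms.

(** * Consequences of the relations *)

Section Relations.
Context (E : groupType).
Local Open Scope group_scope.

Definition comm (g u : E) : E := g * u * g^-1 * u^-1.

Lemma conj_commute (g u : E) : g * u = u * g -> u ^ g^-1 = u.
Proof. by move=> gu; rewrite conjgE invgK mulgA gu mulgK. Qed.

Lemma comm_eq1 (g u : E) : comm g u = 1 -> commute g u.
Proof. by move=> /divg1_eq e; rewrite /commute -{2}e mulgVK. Qed.

(** Conjugate q = [z, y] by x, which fixes z and multiplies y by w = [x, y]. For
    elementary matrices both sides compute the (14) entry. *)
Lemma comm_shift (x y z w q : E) :
    x * y = w * (y * x) -> z * y = q * (y * z) -> commute x z -> commute w q ->
  comm x q = comm z w.
Proof.
move=> xy zy xz wq.
have qE : q = z * y * z^-1 * y^-1 by rewrite zy !mulgA !mulgK.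
have xyE : y ^ x^-1 = w * y by rewrite conjgE invgK mulgA xy mulgA mulgK.
have -> : comm x q = q ^ x^-1 * q^-1 by rewrite /comm conjgE invgK !mulgA.
rewrite {1}qE !conjMg !conjVg (conj_commute xz) xyE invgM.
have -> : z * (w * y) * z^-1 * (y^-1 * w^-1) * q^-1
   = z * w * y * z^-1 * y^-1 * (q^-1 * w^-1).
  by rewrite -!mulgA; do 5 congr (_ * _); rewrite -!invgM wq.
by rewrite qE !invgM !invgK !mulgA mulgVK mulgVK mulgK.
Qed.

(** The letters x, y, z, w, q stand for the elementary matrices with entry (12),
    (23), (34), (13), (24), up to sign, and t, s for a basis of the torus acting
    on them with weights (1,0), (-1,1), (0,-1), (0,1), (-1,0). All sides are
    positive words, so that Fox derivatives of inverses never occur. The last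
    relation kills one element of the corner; the commutation of w with z follows
    from it. *)
Record relations (t s x y z w q : E) : Prop := Relations {
  rel_ts : t * s = s * t;
  rel_tx : t * x = x * (x * t);  rel_sx : s * x = x * s;
  rel_sy : s * y = y * (y * s);  rel_tsy : t * (s * y) = y * (t * s);
  rel_sz : z * s = s * (z * z);  rel_tz : t * z = z * t;
  rel_sw : s * w = w * (w * s);  rel_tw : t * w = w * t;
  rel_tq : q * t = t * (q * q);  rel_sq : s * q = q * s;
  rel_xy : x * y = w * (y * x);  rel_zy : z * y = q * (y * z);
  rel_wx : w * x = x * w;  rel_wy : w * y = y * w;
  rel_qy : q * y = y * q;  rel_qz : q * z = z * q;
  rel_wq : w * q = q * w;  rel_xz : x * z = z * x;  rel_xq : x * q = q * x
}.

Context (t s x y z w q : E) (rels : relations t s x y z w q).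

Lemma weight_x : exists2 X, weight_hom t s 1 0 X & X 1%R = x.
Proof.
have [|X [XD X1 Xt]] := @dy_hom_extend _ x t.
  by rewrite conjgE invgK mulgA (rel_tx rels) mulgA mulgK.
exists X => //; split=> //; apply: (dy_hom_act XD Xt (esym (rel_ts rels))).
by rewrite pw0 X1 (conj_commute (rel_sx rels)).
Qed.

Lemma weight_w : exists2 X, weight_hom t s 0 1 X & X 1%R = w.
Proof.
have [|X [XD X1 Xs]] := @dy_hom_extend _ w s.
  by rewrite conjgE invgK mulgA (rel_sw rels) mulgA mulgK.
exists X => //; split=> //; apply: (dy_hom_act XD Xs (rel_ts rels)).
by rewrite pw0 X1 (conj_commute (rel_tw rels)).
Qed.

Lemma weight_z : exists2 X, weight_hom t s 0 (-1) X & X 1%R = z.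
Proof.
have [|X [XD X1 Xs]] := @dy_hom_extend _ z s^-1.
  by rewrite conjgE !invgK (rel_sz rels) mulKg.
exists X => //; split=> //.
  apply: (dy_hom_act XD Xs); first exact/commuteV/(rel_ts rels).
  by rewrite pw0 X1 (conj_commute (rel_tz rels)).
by move=> r; have := dy_hom_actV Xs r; rewrite invgK.
Qed.

Lemma weight_q : exists2 X, weight_hom t s (-1) 0 X & X 1%R = q.
Proof.
have [|X [XD X1 Xt]] := @dy_hom_extend _ q t^-1.
  by rewrite conjgE !invgK (rel_tq rels) mulKg.
exists X => //; split=> //.
  by move=> r; have := dy_hom_actV Xt r; rewrite invgK.
apply: (dy_hom_act XD Xt); first exact/commuteV/esym/(rel_ts rels).
by rewrite pw0 X1 (conj_commute (rel_sq rels)).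
Qed.

(** Unlike the other generators, y is fixed by neither t nor s, but by t s. *)
Lemma weight_y : exists2 X, weight_hom t s (-1) 1 X & X 1%R = y.
Proof.
have [|X [XD X1 Xs]] := @dy_hom_extend _ y s.
  by rewrite conjgE invgK mulgA (rel_sy rels) mulgA mulgK.
exists X => //; split=> // r.
have ts_s : commute (t * s) s by rewrite /commute {1}(rel_ts rels) mulgA.
have Xts : forall r, X r ^ (t * s)^-1 = X (pw 0 * r)%R.
  apply: (dy_hom_act XD Xs ts_s); rewrite pw0 X1; apply: conj_commute.
  by rewrite -mulgA (rel_tsy rels).
have := Xts (pw (-1) * r)%R; rewrite pw0 mul1r invgM conjgM Xs.
by rewrite mulrA -pwD pw0 mul1r.
Qed.

Section NormalForm.
Context (X Y Z W Q : dy -> E).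
Hypotheses (fX : weight_hom t s 1 0 X) (X1 : X 1%R = x).
Hypotheses (fY : weight_hom t s (-1) 1 Y) (Y1 : Y 1%R = y).
Hypotheses (fZ : weight_hom t s 0 (-1) Z) (Z1 : Z 1%R = z).
Hypotheses (fW : weight_hom t s 0 1 W) (W1 : W 1%R = w).
Hypotheses (fQ : weight_hom t s (-1) 0 Q) (Q1 : Q 1%R = q).

Lemma commute_xz a c : commute (X a) (Z c).
Proof. by apply: (weight_commute fX fZ) => //; rewrite X1 Z1; exact: (rel_xz rels). Qed.
Lemma commute_wx d a : commute (W d) (X a).
Proof. by apply: (weight_commute fW fX) => //; rewrite X1 W1; exact: (rel_wx rels). Qed.
Lemma commute_wy d b : commute (W d) (Y b).
Proof. by apply: (weight_commute fW fY) => //; rewrite Y1 W1; exact: (rel_wy rels). Qed.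
Lemma commute_qy e b : commute (Q e) (Y b).
Proof. by apply: (weight_commute fQ fY) => //; rewrite Q1 Y1; exact: (rel_qy rels). Qed.
Lemma commute_qz e c : commute (Q e) (Z c).
Proof. by apply: (weight_commute fQ fZ) => //; rewrite Q1 Z1; exact: (rel_qz rels). Qed.
Lemma commute_wq d e : commute (W d) (Q e).
Proof. by apply: (weight_commute fW fQ) => //; rewrite Q1 W1; exact: (rel_wq rels). Qed.

Lemma bracket_xy a b : X a * Y b = W (a * b)%R * (Y b * X a).
Proof.
apply: (weight_bracket fX fY fW) => //; last by rewrite X1 Y1 W1; exact: (rel_xy rels).
  exact: commute_wx.
exact: commute_wy.
Qed.

Lemma bracket_zy c b : Z c * Y b = Q (c * b)%R * (Y b * Z c).
Proof.
apply: (weight_bracket fZ fY fQ) => //; last by rewrite Z1 Y1 Q1; exact: (rel_zy rels).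
  exact: commute_qz.
exact: commute_qy.
Qed.

Lemma comm_xq_zw a b c : comm (X a) (Q (c * b)%R) = comm (Z c) (W (a * b)%R).
Proof.
apply: (comm_shift (bracket_xy a b) (bracket_zy c b)); last exact: commute_wq.
exact: commute_xz.
Qed.

(** The parameter of the commutator of X a and Q e is a e, as for matrices, so a
    single variable suffices. *)
Definition corner (e : dy) : E := comm (X 1%R) (Q e).

Lemma comm_xq a e : comm (X a) (Q e) = corner (a * e)%R.
Proof.
rewrite -[e in LHS]mul1r comm_xq_zw -[(a * e)%R in LHS]mul1r -comm_xq_zw.
by rewrite mul1r.
Qed.

Lemma cornerE e : corner e = comm (Z 1%R) (W e).
Proof. by rewrite /corner -[e in LHS]mul1r comm_xq_zw mul1r. Qed.

(** The commutator is multiplicative in e because Q commutes with its values, which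
    is visible from the expression by Z and W. *)
Lemma cornerD : dy_hom corner.
Proof.
have [_ [QD _ _]] := (fX, fQ).
move=> e e'; have : commute (Q e) (corner e').
  rewrite cornerE /comm; apply: commuteM; last exact/commuteV/commute_sym/commute_wq.
  apply: commuteM; last exact/commuteV/commute_qz.
  by apply: commuteM; [exact: commute_qz | exact/commute_sym/commute_wq].
move/commute_sym/commuteV; rewrite /commute => c.
have -> : corner (e + e')%R = X 1%R * Q e * (X 1%R)^-1 * corner e' * (Q e)^-1.
  by rewrite /corner QD /comm invgM !mulgA mulgVK.
by rewrite -mulgA c mulgA.
Qed.

Lemma corner1 : corner 1%R = 1.
Proof. by rewrite /corner /comm X1 Q1 (rel_xq rels) mulgK mulgV. Qed.

(** If squaring is injective at 1 in K, then corner (2^-n) = 1 by induction on n;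
    if K has exponent 2, then every value is trivial, being the square of the value
    at half the parameter. *)
Lemma corner_trivial (K : E -> Prop) : (forall e, K (corner e)) ->
    (forall u, K u -> u * u = 1 -> u = 1) \/ (forall u, K u -> u * u = 1) ->
  forall e, corner e = 1.
Proof.
move=> Kh K2.
have sqr i : corner (pw (i - 1)%R) * corner (pw (i - 1)%R) = corner (pw i).
  by rewrite -cornerD -pw_half.
elim/dy_ind => [i|e e' h h'|e h]; first last.
- by rewrite (dy_homN _ cornerD) h invg1.
- by rewrite cornerD h h' mulg1.
case: K2 => [tf|ex]; last by rewrite -sqr; exact: ex.
have pos n : corner (pw n%:Z) = 1.
  elim: n => [|n IH]; first by rewrite pw0 corner1.
  by rewrite -sqr -addn1 PoszD addrK IH mulg1.
have neg n : corner (pw (- n%:Z)) = 1.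
  elim: n => [|n IH]; first by rewrite oppr0 pw0 corner1.
  by apply: tf => //; rewrite -addn1 PoszD opprD sqr IH.
by case: i => n; rewrite ?NegzE; [exact: pos | exact: neg].
Qed.

Hypothesis corner_eq1 : forall e, corner e = 1.

Lemma commute_xq a e : commute (X a) (Q e).
Proof.
by apply: comm_eq1; rewrite comm_xq corner_eq1.
Qed.

Lemma commute_zw c d : commute (Z c) (W d).
Proof.
by apply: comm_eq1; have := comm_xq_zw d 1%R c; rewrite !mulr1 comm_xq corner_eq1.
Qed.

Lemma commuteA (g u v : E) : commute g u -> g * (u * v) = u * (g * v).
Proof. by move=> gu; rewrite mulgA gu mulgA. Qed.

(** The order Y X Z W Q is chosen so that only right multiplication by Y creates
    brackets. *)
Definition normal b a c d e : E := Y b * (X a * (Z c * (W d * Q e))).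

Lemma normalQ b a c d e r : normal b a c d e * Q r = normal b a c d (e + r)%R.
Proof. by have [QD _ _] := fQ; rewrite /normal QD !mulgA. Qed.

Lemma normalW b a c d e r : normal b a c d e * W r = normal b a c (d + r)%R e.
Proof.
by have [WD _ _] := fW; rewrite /normal -!mulgA -(commute_wq r) WD !mulgA.
Qed.

Lemma normalZ b a c d e r : normal b a c d e * Z r = normal b a (c + r)%R d e.
Proof.
have [ZD _ _] := fZ; rewrite /normal -!mulgA commute_qz.
by rewrite (commuteA _ (commute_sym (commute_zw _ _))) ZD !mulgA.
Qed.

Lemma normalX b a c d e r : normal b a c d e * X r = normal b (a + r)%R c d e.
Proof.
have [XD _ _] := fX; rewrite /normal -!mulgA -commute_xq (commuteA _ (commute_wx _ _)).
by rewrite (commuteA _ (commute_sym (commute_xz _ _))) XD !mulgA.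
Qed.

Lemma normalY b a c d e r : normal b a c d e * Y r =
  normal (b + r)%R a c (d + a * r)%R (e + c * r)%R.
Proof.
have [YD _ _] := fY; have [WD _ _] := fW; have [QD _ _] := fQ.
rewrite /normal -!mulgA commute_qy (commuteA _ (commute_wy _ _)).
rewrite (mulgA (Z c) (Y r)) bracket_zy -!mulgA (commuteA _ (commute_xq _ _)).
rewrite (mulgA (X a) (Y r)) bracket_xy -!mulgA.
rewrite (commuteA _ (commute_wy _ _)) (commuteA _ (commute_wx _ _)).
rewrite (commuteA _ (commute_sym (commute_zw _ _))) (mulgA (W _)) -WD.
rewrite (commuteA _ (commute_qy _ _)) (commuteA _ (commute_sym (commute_xq _ _))).
rewrite (commuteA _ (commute_qz _ _)) (commuteA _ (commute_sym (commute_wq _ _))).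
by rewrite -QD mulgA -YD [(_ + d)%R]addrC [(_ + e)%R]addrC.
Qed.

Lemma normal_torus_t b a c d e i j :
  normal b a c d e * torus t s i j * t = normal b a c d e * torus t s (i + 1)%R j.
Proof.
rewrite -mulgA; congr (_ * _); rewrite /torus zpowD -!mulgA; congr (_ * _).
have ts := rel_ts rels.
by case: j => n; apply/commute_sym; [exact/commuteX | exact/commuteV/commuteX].
Qed.

Lemma normal_torus_s b a c d e i j :
  normal b a c d e * torus t s i j * s = normal b a c d e * torus t s i (j + 1)%R.
Proof. by rewrite -mulgA /torus zpowD !mulgA. Qed.

End NormalForm.

End Relations.

(** * Abels' group modulo its centre *)

(** The coordinates (b, a, c, d, e) are the parameters in the normal form
    Y b X a Z c W d Q e. *)
Definition unip : Type := (dy * dy * dy * dy * dy)%type.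
Definition weights : Type := (int * int)%type.

Definition umul (u v : unip) : unip :=
  let: (b, a, c, d, e) := u in let: (b', a', c', d', e') := v in
  (b + b', a + a', c + c', d + d' + a * b', e + e' + c * b').
Definition uone : unip := (0, 0, 0, 0, 0).
Definition uinv (u : unip) : unip :=
  let: (b, a, c, d, e) := u in (- b, - a, - c, - d + a * b, - e + c * b).

Definition act (T : weights) (u : unip) : unip :=
  let: (b, a, c, d, e) := u in let: (i, j) := T in
  (pw (- i + j) * b, pw i * a, pw (- j) * c, pw j * d, pw (- i) * e).

Arguments umul : simpl never.
Arguments act : simpl never.

Lemma umulA : associative umul.
Proof.
move=> [[[[b a] c] d] e] [[[[b' a'] c'] d'] e'] [[[[b'' a''] c''] d''] e''].
by congr (_, _, _, _, _); ring.
Qed.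

Lemma umul1u : left_id uone umul.
Proof. by move=> [[[[b a] c] d] e]; congr (_, _, _, _, _); ring. Qed.

Lemma umulu1 : right_id uone umul.
Proof. by move=> [[[[b a] c] d] e]; congr (_, _, _, _, _); ring. Qed.

Lemma umulVu : left_inverse uone uinv umul.
Proof. by move=> [[[[b a] c] d] e]; congr (_, _, _, _, _); ring. Qed.

Lemma umuluV : right_inverse uone uinv umul.
Proof. by move=> [[[[b a] c] d] e]; congr (_, _, _, _, _); ring. Qed.

Lemma actM (T : weights) : {morph act T : u v / umul u v}.
Proof.
move: T => [i j] [[[[b a] c] d] e] [[[[b' a'] c'] d'] e'].
have ej : pw j = pw i * pw (- i + j) by rewrite -pwD addrA subrr add0r.
have ei : pw (- i) = pw (- j) * pw (- i + j) by rewrite -pwD addrCA addNr addr0.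
congr (_, _, _, _, _); rewrite ?mulrDr //.
  by rewrite {3}ej mulrACA.
by rewrite {3}ei mulrACA.
Qed.

Lemma actD (T T' : weights) (u : unip) : act (T + T') u = act T (act T' u).
Proof.
move: T T' u => [i j] [i' j'] [[[[b a] c] d] e].
have -> : (i, j) + (i', j') = (i + i', j + j') :> weights by [].
by rewrite /act !opprD !pwD; congr (_, _, _, _, _); ring.
Qed.

Lemma act0 (u : unip) : act 0 u = u.
Proof.
move: u => [[[[b a] c] d] e].
have -> : (0 : weights) = (0, 0) by [].
by rewrite /act oppr0 addr0 !pw0 !mul1r.
Qed.

(** The semidirect product of the unipotent part by the torus Z^2. *)
Definition abelsq : Type := (unip * weights)%type.

Definition amul (g h : abelsq) : abelsq := (umul g.1 (act g.2 h.1), g.2 + h.2).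
Definition aone : abelsq := (uone, 0).
Definition ainv (g : abelsq) : abelsq := (act (- g.2) (uinv g.1), - g.2).

Lemma act_one (T : weights) : act T uone = uone.
Proof. by move: T => [i j]; rewrite /act /uone !mulr0. Qed.

Lemma amulA : associative amul.
Proof.
move=> [u T] [v T'] [w T'']; rewrite /amul /=.
by rewrite actM actD umulA addrA.
Qed.

Lemma amul1g : left_id aone amul.
Proof. by move=> [u T]; rewrite /amul /aone /= act0 umul1u add0r. Qed.

Lemma amulg1 : right_id aone amul.
Proof. by move=> [u T]; rewrite /amul /aone /= act_one umulu1 addr0. Qed.

Lemma amulVg : left_inverse aone ainv amul.
Proof. by move=> [u T]; rewrite /amul /ainv /= -actM umulVu act_one addNr. Qed.

Lemma amulgV : right_inverse aone ainv amul.
Proof. by move=> [u T]; rewrite /amul /ainv /= -actD subrr act0 umuluV. Qed.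

HB.instance Definition _ := Choice.on abelsq.
HB.instance Definition _ := isGroup.Build abelsq amulA amul1g amulg1 amulVg amulgV.

(** * The central extension, and failure of FP_2 over the integers *)

(** The cocycle of the extension by the (14) entry. It is the bilinear form
    ((a, c, d, e), (a', c', d', e')) |-> d c' - a e', evaluated after moving the
    first vector by the y-coordinate b' of the second factor; the form is
    invariant under this move and under the torus, its two monomials having
    weight 0. *)
Definition ucoc (u v : unip) : dy :=
  let: (b, a, c, d, e) := u in let: (b', a', c', d', e') := v in
  (d + a * b') * c' - a * e'.
Definition acoc (g h : abelsq) : dy := ucoc g.1 (act g.2 h.1).

Lemma ucoc_act (T : weights) (u v : unip) : ucoc (act T u) (act T v) = ucoc u v.
Proof.
move: T u v => [i j] [[[[b a] c] d] e] [[[[b' a'] c'] d'] e']; rewrite /ucoc /act.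
rewrite pwD; have := pwNK i; have := pwNK j.
move: (pw i) (pw (- i)) (pw j) (pw (- j)) => p p' r r' rr pp.
have -> : (r * d + p * a * (p' * r * b')) * (r' * c') - p * a * (p' * e') =
  (r' * r) * (d + (p' * p) * a * b') * c' - (p' * p) * a * e' by ring.
by rewrite rr pp !mul1r.
Qed.

Lemma ucocE (u v w : unip) : ucoc u v + ucoc (umul u v) w = ucoc u (umul v w) + ucoc v w.
Proof.
move: u v w => [[[[b a] c] d] e] [[[[b' a'] c'] d'] e'] [[[[b'' a''] c''] d''] e''].
by rewrite /ucoc /umul; ring.
Qed.

Lemma acocE (g h k : abelsq) : acoc g h + acoc (g * h)%g k = acoc g (h * k)%g + acoc h k.
Proof.
move: g h k => [u T] [v T'] [w T'']; rewrite /acoc /=.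
by rewrite actM actD ucocE; congr (_ + _); exact: ucoc_act.
Qed.

Lemma pw_nat n : pw n%:Z = (2 ^+ n : int)%:~R.
Proof. by apply: val_inj; rewrite rmorph_int rmorphXn. Qed.

Lemma common_denominator m (v : 'I_m -> dy) :
  exists N : nat, forall c : 'I_m -> int, exists z : int,
    pw N%:Z * \sum_(j < m) v j *~ c j = z%:~R.
Proof.
have /boolp.choice [num /boolp.choice [den vE]] := fun j => dy_repr (v j).
exists (\sum_j den j)%N => c.
exists (\sum_j num j * 2 ^+ (\sum_(k | k != j) den k) * c j).
rewrite mulr_sumr [RHS]rmorph_sum; apply: eq_bigr => j _ /=.
rewrite vE (bigD1 j) //= PoszD pwD -mulrzr !rmorphM /= -pw_nat.
rewrite mulrACA [pw (den j)%:Z * _]mulrC -mulrA [_ * (pw _ * _)]mulrA.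
by rewrite -(mulrA (num j)%:~R) pwNK mulr1 mulrA.
Qed.

Lemma pw_neg1_nonint (z : int) : pw (-1) <> z%:~R.
Proof.
move=> zE; have : (z * 2)%:~R = 1%:~R :> dy.
  rewrite rmorphM /= -zE; have -> : 2%:~R = pw 1 :> dy by exact: val_inj.
  exact: pwNK.
move=> /(congr1 val); rewrite !rmorph_int => /intr_inj e.
by have : (2 %| 1)%Z by apply/dvdzP; exists z.
Qed.

(** The elements with a = 1 and with e = r commute in the quotient, while their
    lifts have commutator r in the corner, up to sign. Finitely many elements of
    Z[1/2] have a common denominator 2^N, which r = 2^-(N+1) does not admit. *)
Lemma abelsq_not_FP2_int : ~ type_FP 2 int abelsq.
Proof.
move=> /FP2_cocycle /(_ acocE) [C [m [v vP]]].
have [N NP] := common_denominator v.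
pose r := pw (- N%:Z - 1).
pose g : abelsq := ((0, 1, 0, 0, 0), 0); pose h : abelsq := ((0, 0, 0, 0, r), 0).
have gh : (g * h = h * g)%g.
  rewrite /g /h; congr (_, _); rewrite !act0.
  by congr (_, _, _, _, _); ring.
have ghE : acoc g h = - r.
  by rewrite -[acoc g h]/(ucoc g.1 (act 0 h.1)) act0 /ucoc /g /h /=; ring.
have hgE : acoc h g = 0.
  by rewrite -[acoc h g]/(ucoc h.1 (act 0 g.1)) act0 /ucoc /g /h /=; ring.
have [c cE] := vP g h; have [c' c'E] := vP h g.
have [z zE] := NP (fun j => c' j - c j).
apply: (@pw_neg1_nonint z); rewrite -zE.
have -> : \sum_(j < m) v j *~ (c' j - c j) = r.
  transitivity (acoc h g - acoc g h); last by rewrite ghE hgE sub0r opprK.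
  rewrite cE c'E gh opprD addrACA.
  under eq_bigr do rewrite mulrzBr.
  rewrite sumrB -[LHS]add0r; congr (_ + _); ring.
by rewrite -pwD addrA subrr sub0r.
Qed.

(** * Lifting the group to extensions in which the relations hold *)

(** The generators t, s, x, y, z, w, q are numbered from 0 to 6, and the pairs of
    words follow the order of the fields of relations. *)
Definition rel_table : seq (seq nat * seq nat) :=
  [:: ([:: 0; 1], [:: 1; 0]);
      ([:: 0; 2], [:: 2; 2; 0]); ([:: 1; 2], [:: 2; 1]);
      ([:: 1; 3], [:: 3; 3; 1]); ([:: 0; 1; 3], [:: 3; 0; 1]);
      ([:: 4; 1], [:: 1; 4; 4]); ([:: 0; 4], [:: 4; 0]);
      ([:: 1; 5], [:: 5; 5; 1]); ([:: 0; 5], [:: 5; 0]);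
      ([:: 6; 0], [:: 0; 6; 6]); ([:: 1; 6], [:: 6; 1]);
      ([:: 2; 3], [:: 5; 3; 2]); ([:: 4; 3], [:: 6; 3; 4]);
      ([:: 5; 2], [:: 2; 5]); ([:: 5; 3], [:: 3; 5]);
      ([:: 6; 3], [:: 3; 6]); ([:: 6; 4], [:: 4; 6]);
      ([:: 5; 6], [:: 6; 5]); ([:: 2; 4], [:: 4; 2]); ([:: 2; 6], [:: 6; 2])]%N.

Definition rel_lhs (j : 'I_20) : seq 'I_7 :=
  [seq inord k | k <- (nth ([::], [::]) rel_table j).1].
Definition rel_rhs (j : 'I_20) : seq 'I_7 :=
  [seq inord k | k <- (nth ([::], [::]) rel_table j).2].

Lemma relationsP (E : groupType) (g : 'I_7 -> E) :
  (forall j, eval g (rel_lhs j) = eval g (rel_rhs j)) <->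
  relations (g (inord 0)) (g (inord 1)) (g (inord 2)) (g (inord 3))
    (g (inord 4)) (g (inord 5)) (g (inord 6)).
Proof.
split=> [H | [r0 r1 r2 r3 r4 r5 r6 r7 r8 r9 r10 r11 r12 r13 r14 r15 r16 r17 r18 r19] j].
  have {}H k (lt : (k < 20)%N) := H (Ordinal lt).
  split; [have := H 0%N isT|have := H 1%N isT|have := H 2%N isT|have := H 3%N isT
    |have := H 4%N isT|have := H 5%N isT|have := H 6%N isT|have := H 7%N isT
    |have := H 8%N isT|have := H 9%N isT|have := H 10%N isT|have := H 11%N isT
    |have := H 12%N isT|have := H 13%N isT|have := H 14%N isT|have := H 15%N isT
    |have := H 16%N isT|have := H 17%N isT|have := H 18%N isT|have := H 19%N isT];
  by rewrite /eval !big_cons !big_nil !mulg1.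
rewrite /eval; case: j => n lt.
do 20 (case: n lt => [|n] lt; first by rewrite !big_cons !big_nil !mulg1).
by [].
Qed.

Definition unit_t : abelsq := (uone, (1, 0)).
Definition unit_s : abelsq := (uone, (0, 1)).
Definition elem_y (b : dy) : abelsq := ((b, 0, 0, 0, 0), 0).
Definition elem_x (a : dy) : abelsq := ((0, a, 0, 0, 0), 0).
Definition elem_z (c : dy) : abelsq := ((0, 0, c, 0, 0), 0).
Definition elem_w (d : dy) : abelsq := ((0, 0, 0, d, 0), 0).
Definition elem_q (e : dy) : abelsq := ((0, 0, 0, 0, e), 0).

Definition abelsq_gen (i : 'I_7) : abelsq :=
  nth 1%g [:: unit_t; unit_s; elem_x 1; elem_y 1; elem_z 1; elem_w 1; elem_q 1] i.

Lemma abelsq_relations :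
  relations unit_t unit_s (elem_x 1) (elem_y 1) (elem_z 1) (elem_w 1) (elem_q 1).
Proof.
split; congr (_, _); congr (_, _, _, _, _); apply: val_inj; reflexivity.
Qed.

Definition incl (u : unip) : abelsq := (u, 0).
Definition tor (T : weights) : abelsq := (uone, T).

Lemma inclM u v : (incl u * incl v)%g = incl (umul u v).
Proof. by congr (_, _); rewrite act0. Qed.

Lemma torM T T' : (tor T * tor T')%g = tor (T + T').
Proof. by congr (_, _); rewrite act_one umul1u. Qed.

Lemma incl_tor u T : (incl u * tor T)%g = (u, T).
Proof. by congr (_, _); rewrite ?act0 ?umulu1 ?add0r. Qed.

Lemma tor_conj u T : (incl u ^ (tor T)^-1)%g = incl (act T u).
Proof.
rewrite conjgE invgK mulgA; apply: (mulIg (tor T)); rewrite mulgVK incl_tor.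
by congr (_, _); rewrite ?umul1u ?addr0.
Qed.

Lemma torV T : ((tor T)^-1)%g = tor (- T).
Proof. by apply: (mulgI (tor T)); rewrite mulgV torM subrr. Qed.

Lemma zpow_tor T m : zpow (tor T) m = tor (T *~ m).
Proof.
have X n : (tor T ^+ n)%g = tor (T *+ n).
  by elim: n => [|n IH] //; rewrite expgS IH torM mulrS.
by case: m => n /=; rewrite X ?torV // NegzE.
Qed.

Lemma torusE i j : torus unit_t unit_s i j = tor (i, j).
Proof.
rewrite /torus -[unit_t]/(tor (1, 0)) -[unit_s]/(tor (0, 1)) !zpow_tor torM.
congr tor; rewrite [LHS]surjective_pairing (raddfD fst) (raddfD snd).
by rewrite !(raddfMz fst) !(raddfMz snd) /= !mul0rz !intz addr0 add0r.
Qed.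

Lemma weight_hom_incl (al be : int) (f : dy -> unip) :
    (forall r r', f (r + r') = umul (f r) (f r')) ->
    (forall i j r, act (i, j) (f r) = f (pw (al * i + be * j) * r)) ->
  weight_hom unit_t unit_s al be (incl \o f).
Proof.
move=> fD fact; split=> [r r'|r|r] /=; first by rewrite inclM fD.
  by rewrite -[unit_t]/(tor (1, 0)) tor_conj fact mulr1 mulr0 addr0.
by rewrite -[unit_s]/(tor (0, 1)) tor_conj fact mulr1 mulr0 add0r.
Qed.

Lemma elem_x_hom : weight_hom unit_t unit_s 1 0 elem_x.
Proof.
apply: weight_hom_incl => [r r'|i j r]; first by congr (_, _, _, _, _); ring.
by rewrite /act !mulr0 mul0r mul1r addr0.
Qed.

Lemma elem_y_hom : weight_hom unit_t unit_s (-1) 1 elem_y.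
Proof.
apply: weight_hom_incl => [r r'|i j r]; first by congr (_, _, _, _, _); ring.
by rewrite /act !mulr0 mulN1r mul1r.
Qed.

Lemma elem_z_hom : weight_hom unit_t unit_s 0 (-1) elem_z.
Proof.
apply: weight_hom_incl => [r r'|i j r]; first by congr (_, _, _, _, _); ring.
by rewrite /act !mulr0 mul0r mulN1r add0r.
Qed.

Lemma elem_w_hom : weight_hom unit_t unit_s 0 1 elem_w.
Proof.
apply: weight_hom_incl => [r r'|i j r]; first by congr (_, _, _, _, _); ring.
by rewrite /act !mulr0 mul0r mul1r add0r.
Qed.

Lemma elem_q_hom : weight_hom unit_t unit_s (-1) 0 elem_q.
Proof.
apply: weight_hom_incl => [r r'|i j r]; first by congr (_, _, _, _, _); ring.
by rewrite /act !mulr0 mul0r mulN1r addr0.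
Qed.

Lemma elem_normal b a c d e T :
  (normal elem_x elem_y elem_z elem_w elem_q b a c d e * tor T)%g = ((b, a, c, d, e), T).
Proof.
rewrite /normal.
rewrite -[elem_y b]/(incl _) -[elem_x a]/(incl _) -[elem_z c]/(incl _).
rewrite -[elem_w d]/(incl _) -[elem_q e]/(incl _).
rewrite !inclM incl_tor; congr (_, _); rewrite /umul /= !(oppr0, addr0, pw0).
by congr (_, _, _, _, _); ring.
Qed.

Section GeneratorAction.
Context (b a c d e : dy) (i j : int).
Local Notation g := (((b, a, c, d, e), (i, j)) : abelsq).

Lemma abelsqMt : (g * unit_t)%g = ((b, a, c, d, e), (i + 1, j)).
Proof.
by congr (_, _); [rewrite /= act_one umulu1 | congr (_, _); exact: addr0].
Qed.

Lemma abelsqMs : (g * unit_s)%g = ((b, a, c, d, e), (i, j + 1)).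
Proof.
by congr (_, _); [rewrite /= act_one umulu1 | congr (_, _); exact: addr0].
Qed.

Lemma abelsqM_incl u : (g * incl u)%g = (umul g.1 (act (i, j) u), (i, j)).
Proof. by congr (_, _); exact: addr0. Qed.

Lemma abelsqMx r : (g * elem_x r)%g = ((b, a + pw i * r, c, d, e), (i, j)).
Proof.
rewrite -[elem_x r]/(incl _) abelsqM_incl; congr (_, _).
by congr (_, _, _, _, _); ring.
Qed.

Lemma abelsqMy r : (g * elem_y r)%g =
  ((b + pw (- i + j) * r, a, c,
    d + a * (pw (- i + j) * r), e + c * (pw (- i + j) * r)), (i, j)).
Proof.
rewrite -[elem_y r]/(incl _) abelsqM_incl; congr (_, _).
by congr (_, _, _, _, _); ring.
Qed.

Lemma abelsqMz r : (g * elem_z r)%g = ((b, a, c + pw (- j) * r, d, e), (i, j)).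
Proof.
rewrite -[elem_z r]/(incl _) abelsqM_incl; congr (_, _).
by congr (_, _, _, _, _); ring.
Qed.

Lemma abelsqMw r : (g * elem_w r)%g = ((b, a, c, d + pw j * r, e), (i, j)).
Proof.
rewrite -[elem_w r]/(incl _) abelsqM_incl; congr (_, _).
by congr (_, _, _, _, _); ring.
Qed.

Lemma abelsqMq r : (g * elem_q r)%g = ((b, a, c, d, e + pw (- i) * r), (i, j)).
Proof.
rewrite -[elem_q r]/(incl _) abelsqM_incl; congr (_, _).
by congr (_, _, _, _, _); ring.
Qed.

End GeneratorAction.

Lemma ord7_ind (P : 'I_7 -> Prop) :
    P (inord 0) -> P (inord 1) -> P (inord 2) -> P (inord 3) -> P (inord 4) ->
    P (inord 5) -> P (inord 6) ->
  forall k, P k.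
Proof.
move=> P0 P1 P2 P3 P4 P5 P6 k; rewrite -[k]inord_val.
case: k => n /= lt; do 7 (case: n lt => [|n] lt; first by []).
by [].
Qed.

Section Lift.
Context (E : groupType) (pr : E -> abelsq) (t : 'I_7 -> E).
Hypothesis prM : {morph pr : x y / (x * y)%g}.
Hypothesis prt : forall k, pr (t k) = abelsq_gen k.
Hypothesis trel : forall j, eval t (rel_lhs j) = eval t (rel_rhs j).
Hypothesis ker2 : (forall x, pr x = 1%g -> (x * x)%g = 1%g -> x = 1%g)
  \/ (forall x, pr x = 1%g -> (x * x)%g = 1%g).

Lemma pr1 : pr 1%g = 1%g.
Proof. by apply: (mulgI (pr 1%g)); rewrite -prM !mulg1. Qed.

Lemma prV x : pr (x^-1)%g = ((pr x)^-1)%g.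
Proof. by apply: (mulgI (pr x)); rewrite -prM !mulgV pr1. Qed.

Lemma prJ x y : pr (x ^ y)%g = (pr x ^ pr y)%g.
Proof. by rewrite !conjgE !prM prV. Qed.

Lemma pr_zpow x m : pr (zpow x m) = zpow (pr x) m.
Proof.
have X n : pr (x ^+ n)%g = (pr x ^+ n)%g.
  by elim: n => [|n IH]; rewrite ?pr1 // !expgS prM IH.
by case: m => n /=; rewrite ?prV X.
Qed.

Lemma weight_hom_pr u v al be X :
  weight_hom u v al be X -> weight_hom (pr u) (pr v) al be (pr \o X).
Proof.
move=> [XD Xu Xv]; split=> [r r'|r|r] /=; first by rewrite XD prM.
  by rewrite -prV -prJ Xu.
by rewrite -prV -prJ Xv.
Qed.

Lemma prt_inord k (lt : (k < 7)%N) :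
  pr (t (inord k)) =
    nth 1%g [:: unit_t; unit_s; elem_x 1; elem_y 1; elem_z 1; elem_w 1; elem_q 1] k.
Proof. by rewrite prt /abelsq_gen inordK. Qed.

(** Any weight (al, be) with al a + be b = 1 determines a root subgroup from its
    value at 1, so the lifted root subgroups project to the given ones. *)
Lemma pr_weight_hom al be X elem k a b :
    weight_hom (t (inord 0)) (t (inord 1)) al be X -> X 1 = t (inord k) ->
    weight_hom unit_t unit_s al be elem -> elem 1 = abelsq_gen (inord k) ->
    al * a + be * b = 1 ->
  forall r, pr (X r) = elem r.
Proof.
move=> fX X1 fe e1 ab; have := weight_hom_pr fX; rewrite !prt_inord //= => fpr.
by apply: (weight_unique fpr fe ab); rewrite /= X1 prt.
Qed.

(** The section writes an element in normal form with lifted root subgroups;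
    compatibility with the generators is the multiplication of normal forms, which
    holds in E once the corner is trivial there. *)
Lemma abelsq_section : exists sec : abelsq -> E,
  (forall g, pr (sec g) = g) /\ (forall g k, sec (g * abelsq_gen k)%g = (sec g * t k)%g).
Proof.
have rels := (relationsP t).1 trel.
have [X fX X1] := weight_x rels; have [Y fY Y1] := weight_y rels.
have [Z fZ Z1] := weight_z rels; have [W fW W1] := weight_w rels.
have [Q fQ Q1] := weight_q rels.
have prX : forall r, pr (X r) = elem_x r.
  by apply: (pr_weight_hom (a := 1) (b := 0) fX X1 elem_x_hom); rewrite ?/abelsq_gen ?inordK.
have prY : forall r, pr (Y r) = elem_y r.
  by apply: (pr_weight_hom (a := 0) (b := 1) fY Y1 elem_y_hom); rewrite ?/abelsq_gen ?inordK.
have prZ : forall r, pr (Z r) = elem_z r.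
  by apply: (pr_weight_hom (a := 0) (b := -1) fZ Z1 elem_z_hom); rewrite ?/abelsq_gen ?inordK.
have prW : forall r, pr (W r) = elem_w r.
  by apply: (pr_weight_hom (a := 0) (b := 1) fW W1 elem_w_hom); rewrite ?/abelsq_gen ?inordK.
have prQ : forall r, pr (Q r) = elem_q r.
  by apply: (pr_weight_hom (a := -1) (b := 0) fQ Q1 elem_q_hom); rewrite ?/abelsq_gen ?inordK.
have hid : forall e, corner X Q e = 1%g.
  apply: (corner_trivial rels fX X1 fY Y1 fZ Z1 fW W1 fQ Q1 (K := fun u => pr u = 1%g)) => // e.
  rewrite /corner /comm !prM !prV prX prQ.
  have -> : (elem_x 1%R * elem_q e = elem_q e * elem_x 1%R)%g.
    rewrite -[elem_x 1]/(incl _) -[elem_q e]/(incl _) !inclM; congr incl.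
    by congr (_, _, _, _, _); ring.
  by rewrite mulgK mulgV.
pose T := torus (t (inord 0)) (t (inord 1)).
pose sec (g : abelsq) : E :=
  let: (b, a, c, d, e, (i, j)) := g in (normal X Y Z W Q b a c d e * T i j)%g.
exists sec; split=> [[[[[[b a] c] d] e] [i j]]|[[[[[b a] c] d] e] [i j]]].
  rewrite /sec /= /normal !prM prX prY prZ prW prQ !pr_zpow.
  rewrite !prt_inord //= -/(torus _ _ _ _) torusE; exact: elem_normal.
have T1 al be V : weight_hom (t (inord 0)) (t (inord 1)) al be V ->
    (T i j * V 1%R = V (pw (al * i + be * j)) * T i j)%g.
  by move=> fV; rewrite (weight_torusE i j 1 fV) mulr1.
apply: ord7_ind; rewrite /abelsq_gen inordK // [nth _ _ _]/=.
- by rewrite abelsqMt /sec -(normal_torus_t rels).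
- by rewrite abelsqMs /sec -normal_torus_s.
- rewrite abelsqMx /sec -X1 -[RHS]mulgA (T1 _ _ _ fX) [RHS]mulgA.
  by rewrite (normalX rels fX X1 fY Y1 fZ Z1 fW W1 fQ Q1 hid) mulr1 mul1r mul0r addr0.
- rewrite abelsqMy /sec -Y1 -[RHS]mulgA (T1 _ _ _ fY) [RHS]mulgA.
  by rewrite (normalY rels fX X1 fY Y1 fZ Z1 fW W1 fQ Q1 hid) mulr1 mul1r mulN1r.
- rewrite abelsqMz /sec -Z1 -[RHS]mulgA (T1 _ _ _ fZ) [RHS]mulgA.
  by rewrite (normalZ rels fX X1 fY Y1 fZ Z1 fW W1 fQ Q1 hid) mulr1 mul0r mulN1r add0r.
- rewrite abelsqMw /sec -W1 -[RHS]mulgA (T1 _ _ _ fW) [RHS]mulgA.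
  by rewrite (normalW rels _ _ _ fW W1 fQ Q1) mulr1 mul0r mul1r add0r.
- rewrite abelsqMq /sec -Q1 -[RHS]mulgA (T1 _ _ _ fQ) [RHS]mulgA.
  by rewrite (normalQ _ _ _ _ fQ) mulr1 mul0r mulN1r addr0.
Qed.

End Lift.

Lemma abelsq_FP2 (R : nzRingType) :
  (exists h : R, h * 2%:R = 1) \/ 2%:R = 0 :> R -> type_FP 2 R abelsq.
Proof.
move=> R2; apply: (type_FP2_presented R2 (s := abelsq_gen) (lhs := rel_lhs) (rhs := rel_rhs)).
  apply/relationsP; rewrite /abelsq_gen !inordK //=; exact: abelsq_relations.
by move=> E pr t prM prt trel ker2; exact: abelsq_section.
Qed.

Theorem theorem6p1 :
  exists G : groupType,
    [/\ type_FP 2 rat G,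
        forall p : nat, prime p -> type_FP 2 'F_p G
      & ~ type_FP 2 int G].
Proof.
exists abelsq; split; last exact: abelsq_not_FP2_int.
  by apply: abelsq_FP2; left; exists (1 / 2%:R); rewrite divfK.
move=> p pp; apply: abelsq_FP2; have [/eqP->|n2] := boolP ((2%:R : 'F_p) == 0).
  by right.
by left; exists (1 / 2%:R); rewrite divfK.
Qed.
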